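(* Let $k_1^1, \dots, k_n^1$ and $k_1^2, \dots, k_n^2$ be two Steiner chains, for the pairs of circles $l_1, m_1$ and $l_2, m_2$ respectively, with common circle $k_1^1=k_1^2$, such that there is an inversion $\psi$ sending $l_1$ and $m_1$ to two concentric circles and also sending $l_2$ and $m_2$ to two concentric circles. Let $k$ be a fixed index. Then: (1) The centers of the circles $c_{1,k}, c_{2,k+1}, c_{3,k+2}, \dots, c_{n,k-1}$ lie on the same conic $\mathcal{H}_k$. (2) The centers of the circles $c^L_{1,k}, c^L_{2,k+1}, c^L_{3,k+2}, \dots, c^L_{n,k-1}$ lie on the same conic $\mathcal{H}^L_k$. (3) The centers of the circles $c^M_{1,k}, c^M_{2,k+1}, c^M_{3,k+2}, \dots, c^M_{n,k-1}$ lie on the same conic $\mathcal{H}^M_k$. (4) The centers of the circles $c_1, c_2, c_3, \dots, c_n$ lie on the same conic $\mathcal{C}$.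
   Context: A Steiner chain of $n$ circles for two non-intersecting circles $l$ and $m$ in the plane is a sequence of pairwise distinct circles $k_1, \dots, k_n$, each tangent to both $l$ and $m$, such that $k_i$ and $k_{i+1}$ are mutually tangent for all $i$, where indices are taken modulo $n$ (so $k_n$ is tangent to $k_1$). For the two chains ($s\in\{1,2\}$): $L_i^s$ is the tangency point of $k_i^s$ and $l_s$; $M_i^s$ is the tangency point of $k_i^s$ and $m_s$; $N_i^s$ is the tangency point of $k_i^s$ and $k_{i+1}^s$. Under the hypotheses of the claim, for indices $i\neq j$ modulo $n$, $c_{i,j}$ denotes the circle through $N_i^1, N_j^1, N_i^2, N_j^2$; $c^L_{i,j}$ the circle through $L_i^1, L_j^1, L_i^2, L_j^2$; $c^M_{i,j}$ the circle through $M_i^1, M_j^1, M_i^2, M_j^2$; and, for each $i$, $c_i$ is the circle through $L_i^1, M_i^1, L_i^2, M_i^2$ (each of these quadruples is concyclic). All indices are modulo $n$, and $k\not\equiv 1 \pmod n$.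
   Formalization: Formalized for n ≥ 3, with the stated concyclicity of the quadruples assumed, and with the added condition that the tangency point of consecutive chain circles lies on neither of the circles l, m; degenerate conics are allowed. *)

(* Defs.v *)
From HB Require Import structures.
From mathcomp Require Import all_boot all_order all_algebra.
From mathcomp Require Import boolp classical_sets reals.

Set Implicit Arguments.
Unset Strict Implicit.
Unset Printing Implicit Defensive.

Import Order.TTheory GRing.Theory Num.Theory.
Local Open Scope classical_set_scope.
Local Open Scope ring_scope.

Definition plane (R : realType) : Type := (R * R)%type.

Definition sqdist (R : realType) (p q : plane R) : R :=
  (p.1 - q.1) ^+ 2 + (p.2 - q.2) ^+ 2.

Record circle (R : realType) : Type := Circle {
  center : plane R;
  radius : R;
  radius_gt0 : 0 < radius
}.

Definition on_circle (R : realType) (c : circle R) : set (plane R) :=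
  [set p | sqdist p (center c) = radius c ^+ 2].

(* Internal and external tangency alike; forces [c] and [d] to be distinct. *)
Definition tangent_at (R : realType) (c d : circle R) (p : plane R) : Prop :=
  on_circle c `&` on_circle d = [set p].

Definition tangent (R : realType) (c d : circle R) : Prop :=
  exists p, tangent_at c d p.

Definition concentric (R : realType) (c d : circle R) : Prop :=
  center c = center d.

(* Inversion in the circle [w].  The value at [center w] is a junk value (the
   centre itself); if [c] passes through [center w], the image of [c] is a line
   together with that point, hence never a circle. *)
Definition inversion (R : realType) (w : circle R) (p : plane R) : plane R :=
  let s := radius w ^+ 2 / sqdist p (center w) in
  ((center w).1 + s * (p.1 - (center w).1),
   (center w).2 + s * (p.2 - (center w).2)).

Definition sends_to_concentric (R : realType) (w l m : circle R) : Prop :=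
  exists l' m' : circle R,
    [/\ inversion w @` on_circle l = on_circle l',
        inversion w @` on_circle m = on_circle m' &
        concentric l' m'].

(* Indices are taken modulo [n]; ['Z_n] is the ring of integers modulo [n] only
   for [1 < n].  The last clause asks that the three pairwise tangent circles
   [k i], [k (i + 1)], [l] do not all touch at one point, and likewise for [m].
   For concentric [l] and [m] it says that the [k i] lie in the annulus between
   [l] and [m]; without it, a closed chain could also step from a circle in the
   annulus to a circle around the inner one that touches [l] or [m] at the very
   same point. *)
Definition steiner_chain (R : realType) (n : nat) (l m : circle R)
    (k : 'Z_n -> circle R) : Prop :=
  [/\ on_circle l `&` on_circle m = set0,
      injective k,
      forall i, tangent (k i) l /\ tangent (k i) m &
      forall i, exists p, [/\ tangent_at (k i) (k (i + 1)) p,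
                              ~ on_circle l p & ~ on_circle m p]].

Definition passes_through (R : realType) (c : circle R) (p q r s : plane R) :
    Prop :=
  [/\ on_circle c p, on_circle c q, on_circle c r & on_circle c s].

(* Uniqueness matters only when the four points are not pairwise distinct. *)
Definition the_circle_through (R : realType) (c : circle R)
    (p q r s : plane R) : Prop :=
  passes_through c p q r s /\
  forall c' : circle R, passes_through c' p q r s -> c' = c.

Definition line (R : realType) (a b c : R) : set (plane R) :=
  [set p | a * p.1 + b * p.2 + c = 0].

(* Concyclic in the sense of inversive geometry: lines count as circles. *)
Definition concyclic (R : realType) (p q r s : plane R) : Prop :=
  (exists c : circle R, passes_through c p q r s) \/
  (exists a b c : R, (a, b) <> (0, 0) /\
     [/\ line a b c p, line a b c q,
         line a b c r & line a b c s]).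

(* Possibly degenerate conics: the zero sets of the real polynomials of degree
   exactly two in two variables. *)
Definition conic (R : realType) (H : set (plane R)) : Prop :=
  exists a b c d e f : R, (a, b, c) <> (0, 0, 0) /\
    H = [set p | a * p.1 ^+ 2 + b * (p.1 * p.2) + c * p.2 ^+ 2
                 + d * p.1 + e * p.2 + f = 0].

(* Main.v *)
Require Import Defs.
From HB Require Import structures.
From mathcomp Require Import all_boot all_order all_algebra.
From mathcomp Require Import boolp classical_sets reals.
From mathcomp Require Import ring lra.

Set Implicit Arguments.
Unset Strict Implicit.
Unset Printing Implicit Defensive.

Import Order.TTheory GRing.Theory Num.Theory.
Local Open Scope classical_set_scope.
Local Open Scope ring_scope.

(** Why the theorem holds.  Invert in [w].  Every circle of both chains avoids
    the centre of inversion, since a line cannot touch two distinct concentric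
    circles, so each chain becomes a closed chain of equal circles in an
    annulus ([inverted_steiner_chain]).  If [O] is the centre of the annulus
    and [C i] are the centres of the circles, then [C (i + 1)] is the image of
    [C i] under a rotation about [O] that does not depend on [i]
    ([ring_chain_rotation]); the tangency points are [O + (1 + e) (C i - O)]
    and [O + (1 - e) (C i - O)], and the contact point of two consecutive
    circles is the midpoint of their centres.

    Because the chains share a circle and [L1 i, M1 i, L2 i, M2 i] are
    concyclic for the two neighbours of that circle, the second chain of
    centres is either equal to the first or its mirror image in a line through
    the common centre ([same_or_reflected]).  The signs of [e] for the two
    chains agree or differ, according to which circle of each pair is the
    outer one.

    A circle with centre [z] and power [D] at the centre of inversion [o]
    becomes [D |q - o|^2 - 2 W (z - o).(q - o) + W^2 = 0], where [W] is the
    squared radius of inversion; in this form the centre [z] of the original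
    circle is a coefficient.  Suppose that the four points of the inverted
    circle are [P], [Q] on a circle about [O] and their mirror images.
    Symmetry in the axis is one linear relation between [D] and [z]: it makes
    [D] a linear function of [z], unless the axis passes through [o], when it
    confines [z] to a line.  A circle that meets a circle about [O] in a chord
    of given length satisfies one quadratic relation in [D] and [z].  As the
    chord lengths do not depend on [i], by the rotation, eliminating [D] gives
    one quadratic equation for all the centres ([reflected_chord_conic]).  For
    the circles through [L1 i, M1 i, L2 i, M2 i] the second relation is that
    the power of [O] is constant, and the centres are even collinear
    ([reflected_ray_conic]).

    The remaining configurations are the following.  If the chains and the
    signs agree, the four points are only two, through which more than one
    circle passes.  If the chains agree and the signs differ, the points lie
    on two rays from [O], the power of [O] is again constant, and this
    replaces the relation given by the axis ([swapped_chord_conic]).  If the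
    chains are mirror images and the signs differ, the assumed concyclicity is
    contradictory as soon as there are four circles
    ([swapped_reflection_absurd]), while for three circles there are only
    three centres ([three_circles_conic]). *)

(** * Circles and tangency *)

(** An equation that follows from hypotheses [c_i = d_i] is proved below by
    exhibiting multipliers: [eqD] and [eqM] assemble the combination of the
    hypotheses, and [eq_comb] leaves a polynomial identity. *)
Lemma eqD (R : realType) (a b c d : R) : a = b -> c = d -> a + c = b + d.
Proof. by move=> -> ->. Qed.

Lemma eqM (R : realType) (k a b : R) : a = b -> k * a = k * b.
Proof. by move=> ->. Qed.

Lemma eq_comb (R : realType) (a b c d : R) : c = d -> a - b = c - d -> a = b.
Proof. by move=> ->; rewrite subrr => /subr0_eq. Qed.

Section Circles.
Variable R : realType.
Implicit Types (p q u v x O C nrm : plane R) (t s : R) (c d : circle R).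

Definition dot u v : R := u.1 * v.1 + u.2 * v.2.

Definition cross u v : R := u.1 * v.2 - u.2 * v.1.

Definition along O C t : plane R :=
  (O.1 + t * (C.1 - O.1), O.2 + t * (C.2 - O.2)).

Lemma plane_eq p q : p.1 = q.1 -> p.2 = q.2 -> p = q.
Proof. by case: p q => [a b] [a' b'] /= -> ->. Qed.

Lemma sqdist_ge0 p q : 0 <= sqdist p q.
Proof. by rewrite addr_ge0 ?sqr_ge0. Qed.

Lemma sqdist_eq0 p q : sqdist p q = 0 -> p = q.
Proof.
move/eqP; rewrite /sqdist paddr_eq0 ?sqr_ge0 // !sqrf_eq0 !subr_eq0.
by case/andP=> /eqP h1 /eqP h2; apply: plane_eq.
Qed.

Lemma sqdist_neq0 p q : p <> q -> sqdist p q != 0.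
Proof. by move=> npq; apply/eqP => /sqdist_eq0. Qed.

Lemma sqdist_gt0 p q : p <> q -> 0 < sqdist p q.
Proof. by move=> npq; rewrite lt0r sqdist_neq0 ?sqdist_ge0. Qed.

Lemma sqdistC p q : sqdist p q = sqdist q p.
Proof. by rewrite /sqdist; ring. Qed.

Lemma circle_eq c d : center c = center d -> radius c = radius d -> c = d.
Proof.
case: c d => [c r hr] [d s hs] /= ecd ers; subst d s.
by rewrite (bool_irrelevance hr hs).
Qed.

(** The ends of the horizontal and the vertical diameter of [c] lie on [d],
    and the two ends of a diameter are equidistant from the centre of [d];
    this determines both coordinates of that centre. *)
Lemma circle_ext c d : (forall p, on_circle c p <-> on_circle d p) -> c = d.
Proof.
move=> h; have := h; move: c d h => [c r hr] [d s hs] /=.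
rewrite /on_circle /sqdist /= => h _.
have e1 := proj1 (h (c.1 + r, c.2)); have e2 := proj1 (h (c.1 - r, c.2)).
have e3 := proj1 (h (c.1, c.2 + r)); have e4 := proj1 (h (c.1, c.2 - r)).
move: e1 e2 e3 e4 => /=.
move=> /(_ ltac:(ring)) e1 /(_ ltac:(ring)) e2 /(_ ltac:(ring)) e3.
move=> /(_ ltac:(ring)) e4.
have r0 : 4 * r != 0 by rewrite mulf_neq0 ?lt0r_neq0.
have d1 : c.1 = d.1.
  apply/subr0_eq/(mulfI r0); apply: (eq_comb (eqD e1 (eqM (-1) e2))); ring.
have d2 : c.2 = d.2.
  apply/subr0_eq/(mulfI r0); apply: (eq_comb (eqD e3 (eqM (-1) e4))); ring.
apply: circle_eq => /=; first exact: plane_eq.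
apply/eqP; rewrite -(@eqrXn2 _ 2) ?ltW //; apply/eqP.
by rewrite -e1 d1 d2; ring.
Qed.

(** The centre can be moved along the perpendicular bisector of [p] and [q];
    if these points coincide, it can be moved away from [p]. *)
Lemma other_circle_through c p q : on_circle c p -> on_circle c q ->
  exists c', [/\ on_circle c' p, on_circle c' q & c' <> c].
Proof.
move=> cp cq; case: (pselect (p = q)) => [<-{q cq}|npq].
  have r2 : 0 < 2 * radius c by rewrite mulr_gt0 ?radius_gt0.
  have cp' : on_circle (Circle (along p (center c) 2) r2) p.
    by move: cp; rewrite /on_circle /sqdist /= exprMn => <-; ring.
  exists (Circle (along p (center c) 2) r2); split=> // e.
  have := radius_gt0 c; have := congr1 (@radius R) e => /=; lra.
pose z : plane R := ((center c).1 - (p.2 - q.2), (center c).2 + (p.1 - q.1)).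
have ez : sqdist p z = sqdist q z.
  move: cp cq; rewrite /on_circle /sqdist /z /= => <- /esym h.
  by apply: (eq_comb h); ring.
have z0 : 0 < sqdist p z.
  apply: sqdist_gt0 => pz; apply: npq; rewrite pz; apply/esym/sqdist_eq0.
  by rewrite -ez pz /sqdist; ring.
have s0 : 0 < Num.sqrt (sqdist p z) by rewrite sqrtr_gt0.
exists (Circle z s0); split; rewrite /on_circle /= ?sqr_sqrtr ?sqdist_ge0 //.
move=> /(congr1 (@center R)) /= ec; apply: npq.
have h1 := congr1 fst ec; have h2 := congr1 snd ec.
by apply: plane_eq; move: h1 h2; rewrite /z /=; lra.
Qed.

Lemma tangent_atP c d p : tangent_at c d p ->
  [/\ on_circle c p, on_circle d p &
      forall q, on_circle c q -> on_circle d q -> q = p].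
Proof.
move=> h; have hp : (on_circle c `&` on_circle d) p by rewrite h.
by case: hp => cp dp; split=> // q cq dq; have : [set p] q by rewrite -h.
Qed.

(** Both circles are symmetric in the line of their centres, so the mirror
    image of their only common point is this point itself.  If the centres
    coincided, the same argument with the point reflection would put the
    common point at the centre. *)
Lemma tangent_along c d p : tangent_at c d p ->
  center c <> center d /\ exists t, p = along (center c) (center d) t.
Proof.
case/tangent_atP; rewrite /on_circle /= => cp dp uniq.
have ncd : center c <> center d.
  move=> ecd.
  have e : (2 * (center c).1 - p.1, 2 * (center c).2 - p.2) = p.
    apply: uniq; first by rewrite -cp /sqdist /=; ring.
    by rewrite -dp -ecd /sqdist /=; ring.
  have h1 := congr1 fst e; have h2 := congr1 snd e; move: h1 h2 => /= h1 h2.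
  have : radius c ^+ 2 = 0.
    rewrite -cp /sqdist; have -> : p.1 = (center c).1 by lra.
    have -> : p.2 = (center c).2 by lra.
    ring.
  by move/eqP; rewrite sqrf_eq0 gt_eqF ?radius_gt0.
split=> //.
have S0 := sqdist_neq0 ncd.
pose v : plane R :=
  ((center d).1 - (center c).1, (center d).2 - (center c).2).
pose x : plane R := (p.1 - (center c).1, p.2 - (center c).2).
have eS : sqdist (center c) (center d) = dot v v.
  by rewrite /sqdist /dot /v /=; ring.
move: S0; rewrite eS => S0.
pose a := 2 * cross v x / dot v v.
have aS : a * dot v v = 2 * cross v x by rewrite /a divfK.
pose q : plane R := (p.1 + a * v.2, p.2 - a * v.1).
have eq1 : sqdist q (center c) = sqdist p (center c).
  apply: (eq_comb (eqM a aS)); rewrite /q /sqdist /cross /dot /x /=; ring.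
have eq2 : sqdist q (center d) = sqdist p (center d).
  apply: (eq_comb (eqM a aS)); rewrite /q /sqdist /cross /dot /x /v /=; ring.
have eqp : q = p by apply: uniq; rewrite ?eq1 ?eq2.
have h1 := congr1 fst eqp; have h2 := congr1 snd eqp.
move: h1 h2; rewrite /q /v /= => h1 h2.
have cr0 : cross v x = 0.
  have a2 : a * v.2 = 0 by rewrite /v /=; lra.
  have a1 : a * v.1 = 0 by rewrite /v /=; lra.
  have : 2 * cross v x = 0.
    rewrite -aS; apply: (eq_comb (eqD (eqM v.1 a1) (eqM v.2 a2))).
    by rewrite /dot; ring.
  by lra.
pose k := dot x v / dot v v.
have kS : k * dot v v = dot x v by rewrite /k divfK.
exists k; apply: plane_eq => /=; apply: (mulfI S0).
  apply: (eq_comb (eqD (eqM (- v.2) cr0) (eqM (- v.1) kS))).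
  by rewrite /cross /dot /x /v /=; ring.
apply: (eq_comb (eqD (eqM v.1 cr0) (eqM (- v.2) kS))).
by rewrite /cross /dot /x /v /=; ring.
Qed.

End Circles.

(** * Circles tangent to two concentric circles *)

Section ConcentricChains.
Variable R : realType.
Implicit Types (c d l m k : circle R) (p q O C : plane R).

Lemma tangent_sym c d p : tangent_at c d p -> tangent_at d c p.
Proof. by rewrite /tangent_at setIC. Qed.

Lemma tangent_ratio c d p : tangent_at c d p ->
  exists t, [/\ p = along (center c) (center d) t,
    0 < sqdist (center c) (center d),
    t ^+ 2 * sqdist (center c) (center d) = radius c ^+ 2 &
    (1 - t) ^+ 2 * sqdist (center c) (center d) = radius d ^+ 2].
Proof.
move=> tg; have [ncd [t ep]] := tangent_along tg.
have [cp dp _] := tangent_atP tg; exists t; split=> //.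
- exact: sqdist_gt0.
- by rewrite -cp ep /sqdist /=; ring.
- by rewrite -dp ep /sqdist /=; ring.
Qed.

Lemma tangent_sqdist c d p : tangent_at c d p ->
  sqdist (center c) (center d) = (radius c + radius d) ^+ 2 \/
  sqdist (center c) (center d) = (radius c - radius d) ^+ 2.
Proof.
case/tangent_ratio=> t [_ _ h1 h2]; set S := sqdist _ _ in h1 h2 *.
have : (t * (1 - t) * S) ^+ 2 == (radius c * radius d) ^+ 2.
  apply/eqP; rewrite [RHS]exprMn -h1 -h2; ring.
by rewrite eqf_sqr => /orP[] /eqP h; [left|right];
  apply: (eq_comb (eqD (eqM 2 h) (eqD h1 h2))); ring.
Qed.

(** Both ratios satisfy the same equation [(1 - t)^2 S = radius k ^ 2], so
    they are equal or have sum 2; equal ratios would make the concentric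
    circles equal. *)
Lemma tangent_concentric k l m L M : tangent_at k l L -> tangent_at k m M ->
    center l = center m -> radius l != radius m ->
  exists t s, [/\ L = along (center l) (center k) t /\
                  M = along (center l) (center k) s,
    t + s = 2, 0 < sqdist (center l) (center k),
    t ^+ 2 * sqdist (center l) (center k) = radius l ^+ 2 /\
    s ^+ 2 * sqdist (center l) (center k) = radius m ^+ 2 &
    (1 - t) ^+ 2 * sqdist (center l) (center k) = radius k ^+ 2].
Proof.
move=> /tangent_sym/tangent_ratio[t [eL S0 tl tk]].
move=> /tangent_sym/tangent_ratio[s [eM _ sm sk]] elm nlm.
rewrite -elm in eM sm sk; exists t, s; split=> //.
have : (1 - t) ^+ 2 == (1 - s) ^+ 2.
  by apply/eqP/(mulIf (lt0r_neq0 S0)); rewrite tk sk.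
rewrite eqf_sqr => /orP[] /eqP h; last by lra.
have ets : t = s by lra.
case/negP: nlm; rewrite -(@eqrXn2 _ 2) ?ltW ?radius_gt0 //.
by rewrite -tl -sm ets.
Qed.

(** The circle [k] lies in the annulus.  With squares the definition does not
    depend on which of [l] and [m] is the outer circle. *)
Definition between l m k :=
  4 * sqdist (center l) (center k) = (radius l + radius m) ^+ 2 /\
  4 * radius k ^+ 2 = (radius l - radius m) ^+ 2.

(** The circle [k] touches the outer circle from inside and encloses the inner
    one. *)
Definition around l m k :=
  4 * sqdist (center l) (center k) = (radius l - radius m) ^+ 2 /\
  4 * radius k ^+ 2 = (radius l + radius m) ^+ 2.

(** The ratios [t], [s] of the two contact points have sum 2, and the square
    of [t s S] is known; the two cases are the two signs of [t s]. *)
Lemma between_or_around k l m L M : tangent_at k l L -> tangent_at k m M ->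
  center l = center m -> radius l != radius m -> between l m k \/ around l m k.
Proof.
move=> kl km elm nlm.
have [t [s [_ ts _ [tl sm] tk]]] := tangent_concentric kl km elm nlm.
rewrite /between /around; set S := sqdist _ _ in tl sm tk *.
have : (t * s * S) ^+ 2 == (radius l * radius m) ^+ 2.
  apply/eqP; rewrite [RHS]exprMn -tl -sm; ring.
have -> : 4 * S = (t + s) ^+ 2 * S by rewrite ts; ring.
have -> : 4 * radius k ^+ 2 = (t - s) ^+ 2 * S.
  by rewrite -tk (_ : s = 2 - t); [ring | lra].
rewrite eqf_sqr => /orP[] /eqP h; [left|right]; split.
- by apply: (eq_comb (eqD (eqM 2 h) (eqD tl sm))); ring.
- by apply: (eq_comb (eqD (eqM (-2) h) (eqD tl sm))); ring.
- by apply: (eq_comb (eqD (eqM 2 h) (eqD tl sm))); ring.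
- by apply: (eq_comb (eqD (eqM (-2) h) (eqD tl sm))); ring.
Qed.

Lemma between_along k l m L M : tangent_at k l L -> tangent_at k m M ->
    center l = center m -> radius l != radius m -> between l m k ->
  let e := (radius l - radius m) / (radius l + radius m) in
  L = along (center l) (center k) (1 + e) /\
  M = along (center l) (center k) (1 - e).
Proof.
move=> kl km elm nlm [btw _].
have [t [s [[-> ->] ts S0 [tl sm] tk]]] := tangent_concentric kl km elm nlm.
set S := sqdist _ _ in btw tl sm tk S0.
have l0 := radius_gt0 l; have m0 := radius_gt0 m.
have lm0 : 0 < radius l + radius m by rewrite addr_gt0.
pose e := (radius l - radius m) / (radius l + radius m).
have he : e * (radius l + radius m) = radius l - radius m.
  by rewrite /e divfK // lt0r_neq0.
have ht : t = 1 + e.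
  have : (t * (radius l + radius m)) ^+ 2 == (2 * radius l) ^+ 2.
    by apply/eqP; rewrite exprMn -btw mulrCA tl; ring.
  rewrite eqf_sqr => /orP[] /eqP h1.
    apply: (mulIf (lt0r_neq0 lm0)).
    by apply: (eq_comb (eqD h1 (eqM (-1) he))); ring.
  have : (s * (radius l + radius m)) ^+ 2 == (2 * radius m) ^+ 2.
    by apply/eqP; rewrite exprMn -btw mulrCA sm; ring.
  have h2 := eqM (radius l + radius m) ts.
  by rewrite eqf_sqr => /orP[] /eqP h3; lra.
by rewrite /= -/e ht (_ : s = 1 - e) //; lra.
Qed.

(** Two circles around the inner circle have equal radii [(l + m) / 2], so
    tangent ones would have centres at distance [l + m]; but both centres are
    at distance [|l - m| / 2] from the common centre. *)
Lemma around_not_tangent k k' l m p : around l m k -> around l m k' ->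
  ~ tangent_at k k' p.
Proof.
move=> [h1 h2] [h3 h4] /[dup] /tangent_along[ncd _] /tangent_sqdist.
have l0 := radius_gt0 l; have m0 := radius_gt0 m.
have ek : radius k = radius k'.
  apply/eqP; rewrite -(@eqrXn2 _ 2) ?ltW ?radius_gt0 //; apply/eqP.
  by rewrite -h4 in h2; lra.
rewrite -ek subrr expr0n /=; case=> [h|/sqdist_eq0 //].
have tri : sqdist (center k) (center k') <=
    2 * (sqdist (center l) (center k) + sqdist (center l) (center k')).
  rewrite -subr_ge0 /sqdist.
  set a := (center k).1; set b := (center k).2; set a' := (center k').1.
  set b' := (center k').2; set x := (center l).1; set y := (center l).2.
  suff -> : 2 * ((x - a) ^+ 2 + (y - b) ^+ 2 + ((x - a') ^+ 2 + (y - b') ^+ 2))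
    - ((a - a') ^+ 2 + (b - b') ^+ 2) =
    (2 * x - a - a') ^+ 2 + (2 * y - b - b') ^+ 2.
    by rewrite addr_ge0 ?sqr_ge0.
  ring.
have lm : 0 < radius l * radius m by rewrite mulr_gt0.
by rewrite h in tri; lra.
Qed.

(** The radius of each of the two circles is the distance of the other one's
    centre from the common centre [O].  Hence the fourth vertex of the
    parallelogram spanned by the two centres and [O] lies on both circles, so
    it is their contact point, and the parallelogram law computes its distance
    from [O]. *)
Lemma between_around_touch k k' l m p : center l = center m ->
  between l m k -> around l m k' -> tangent_at k k' p ->
  on_circle l p \/ on_circle m p.
Proof.
move=> elm [h1 h2] [h3 h4] /[dup] /tangent_atP[_ _ uniq] /tangent_sqdist tg.
pose q : plane R := ((center k).1 + (center k').1 - (center l).1,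
                     (center k).2 + (center k').2 - (center l).2).
have eqp : q = p.
  apply: uniq; rewrite /on_circle /=.
    have : sqdist q (center k) = sqdist (center l) (center k').
      by rewrite /sqdist /=; ring.
    by move=> ->; lra.
  have : sqdist q (center k') = sqdist (center l) (center k).
    by rewrite /sqdist /=; ring.
  by move=> ->; lra.
rewrite /on_circle /= -elm.
have ep : sqdist p (center l) = 2 * sqdist (center l) (center k) +
   2 * sqdist (center l) (center k') - sqdist (center k) (center k').
  by rewrite -eqp /sqdist /=; ring.
have : (4 * (radius k * radius k')) ^+ 2 ==
       (radius l ^+ 2 - radius m ^+ 2) ^+ 2.
  have := congr2 *%R h2 h4 => h; apply/eqP; apply: (eq_comb h); ring.
rewrite eqf_sqr => /orP[] /eqP h; case: tg => tg; [right|left|left|right];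
  by rewrite ep tg; lra.
Qed.

End ConcentricChains.

(** * Steiner chains of concentric circles *)

Section RingChains.
Variable R : realType.
Implicit Types (c d l m k : circle R) (p q O : plane R) (S T a b e : R).

Definition vec O p : plane R := (p.1 - O.1, p.2 - O.2).

Definition rotate O a b p : plane R :=
  (O.1 + (a * (p.1 - O.1) - b * (p.2 - O.2)),
   O.2 + (b * (p.1 - O.1) + a * (p.2 - O.2))).

(** [S] and [T] are the squares of the radius of the ring and of the distance
    of neighbours. *)
Definition ring_chain n O S T (C : 'Z_n -> plane R) :=
  [/\ forall i, sqdist (C i) O = S,
      forall i, sqdist (C i) (C (i + 1)) = T & injective C].

Lemma Zn_ind n (P : 'Z_n -> Prop) :
  P 0 -> (forall i, P i -> P (i + 1)) -> forall i, P i.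
Proof.
move=> P0 PS i; rewrite -[i]natr_Zp; elim: (nat_of_ord i) => [//|j IH].
by rewrite -natr1; apply: PS.
Qed.

Lemma natr_Zn_neq0 n (j : nat) : (0 < j < n)%N -> (j%:R : 'Z_n) != 0.
Proof.
case/andP=> j0 jn; have n1 : (1 < n)%N by apply: leq_ltn_trans jn.
by rewrite -val_eqE /= val_Zp_nat // modn_small // -lt0n.
Qed.

Lemma ring_chain_gt0 n O S T (C : 'Z_n -> plane R) :
  ring_chain O S T C -> 0 < S.
Proof.
case=> hS _ inj; rewrite -(hS 0); apply: sqdist_gt0 => e0.
have e1 : C 1 = O by apply: sqdist_eq0; rewrite hS -(hS 0) e0 /sqdist; ring.
by have := inj 0 1; rewrite e0 e1 => /(_ erefl)/eqP.
Qed.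

(** The scalar product of the vectors to [C i] and [C (i + 1)] is constant, so
    their cross product is constant up to sign.  If the sign changed at some
    [i], the chain would turn back, [C (i + 2) = C i], against injectivity. *)
Lemma ring_chain_rotation n O S T (C : 'Z_n -> plane R) : (2 < n)%N ->
  ring_chain O S T C ->
  exists a b, b != 0 /\ forall i, C (i + 1) = rotate O a b (C i).
Proof.
move=> n2 ch; have S0 := ring_chain_gt0 ch; have Sn0 := lt0r_neq0 S0.
case: ch => hS hT inj.
pose u i := vec O (C i).
have uu i : dot (u i) (u i) = S.
  by rewrite -(hS i) /dot /sqdist /u /vec /=; ring.
have uv i : dot (u i) (u (i + 1)) = S - T / 2.
  have h := uu i; have h' := uu (i + 1).
  apply: (eq_comb (eqD (eqM (- 2^-1) (hT i)) (eqM 2^-1 (eqD h h')))).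
  by rewrite /dot /sqdist /u /vec /=; field.
pose cr i := cross (u i) (u (i + 1)).
have next i : S * (u (i + 1)).1 = (S - T / 2) * (u i).1 - cr i * (u i).2 /\
              S * (u (i + 1)).2 = (S - T / 2) * (u i).2 + cr i * (u i).1.
  split; rewrite -(uv i) -{1}(uu i) /cr /cross /dot; ring.
have prev i :
    S * (u i).1 = (S - T / 2) * (u (i + 1)).1 + cr i * (u (i + 1)).2 /\
    S * (u i).2 = (S - T / 2) * (u (i + 1)).2 - cr i * (u (i + 1)).1.
  split; rewrite -(uv i) -{1}(uu (i + 1)) /cr /cross /dot; ring.
have cr2 i : cr i ^+ 2 = S ^+ 2 - (S - T / 2) ^+ 2.
  rewrite -(uv i) (_ : S ^+ 2 = dot (u i) (u i) * dot (u (i + 1)) (u (i + 1))).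
    by rewrite /cr /cross /dot; ring.
  by rewrite !uu; ring.
have nopp i : cr (i + 1) != - cr i.
  apply/eqP => h; have [n1' n2'] := next (i + 1); have [p1 p2] := prev i.
  have e : C (i + 1 + 1) = C i.
    rewrite h in n1' n2'.
    have E1 : (u (i + 1 + 1)).1 = (u i).1.
      by apply: (mulfI Sn0); rewrite n1' p1; ring.
    have E2 : (u (i + 1 + 1)).2 = (u i).2.
      by apply: (mulfI Sn0); rewrite n2' p2; ring.
    by move: E1 E2; rewrite /u /vec /= => E1 E2; apply: plane_eq; lra.
  have := inj _ _ e; rewrite -addrA -[RHS]addr0 => /addrI/eqP.
  by rewrite -(natrD _ 1 1); apply/negP/natr_Zn_neq0.
have crS i : cr (i + 1) = cr i.
  have : cr (i + 1) ^+ 2 == cr i ^+ 2 by rewrite !cr2.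
  by rewrite eqf_sqr (negPf (nopp i)) orbF => /eqP.
have crc i : cr i = cr 0 by move: i; apply: Zn_ind => // i <-.
exists ((S - T / 2) / S), (cr 0 / S); split.
  rewrite mulf_neq0 ?invr_eq0 //; apply/eqP => h0.
  by have := nopp 0; rewrite crS h0 oppr0 eqxx.
move=> i; have [n1' n2'] := next i; rewrite crc in n1' n2'.
move: n1' n2'; rewrite /u /vec /= => n1' n2'; apply: plane_eq => /=.
  by apply: (mulfI Sn0); apply: (eq_comb n1'); field.
by apply: (mulfI Sn0); apply: (eq_comb n2'); field.
Qed.

Lemma rotation_shift n O a b (C : 'Z_n -> plane R) :
    (forall i, C (i + 1) = rotate O a b (C i)) ->
  forall j, exists a' b', forall i, C (i + j) = rotate O a' b' (C i).
Proof.
move=> hC; apply: Zn_ind => [|j [a' [b' IH]]].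
  by exists 1, 0 => i; rewrite addr0; apply: plane_eq => /=; ring.
exists (a * a' - b * b'), (a * b' + b * a') => i.
by rewrite addrA hC IH; apply: plane_eq => /=; ring.
Qed.

Lemma sqdist_rotate O a b p :
  sqdist p (rotate O a b p) = ((a - 1) ^+ 2 + b ^+ 2) * sqdist p O.
Proof. by rewrite /sqdist /=; ring. Qed.

Lemma ring_chain_unique n O S T S' T' (C C' : 'Z_n -> plane R) i :
    (2 < n)%N -> ring_chain O S T C -> ring_chain O S' T' C' ->
  C i = C' i -> C (i + 1) = C' (i + 1) -> C =1 C'.
Proof.
move=> n2 ch ch' e0 e1.
have [a [b [_ h]]] := ring_chain_rotation n2 ch.
have [a' [b' [_ h']]] := ring_chain_rotation n2 ch'.
have S0 := lt0r_neq0 (ring_chain_gt0 ch).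
have [ea eb] : a = a' /\ b = b'.
  move: e1; rewrite h h' -e0 => e1.
  have := congr1 fst e1; have := congr1 snd e1 => /= E2 E1.
  have eS : sqdist (C i) O = S by case: ch.
  split; apply: (mulIf S0); rewrite -eS.
    apply: (eq_comb (eqD (eqM ((C i).1 - O.1) E1) (eqM ((C i).2 - O.2) E2))).
    by rewrite /sqdist; ring.
  apply: (eq_comb (eqD (eqM (- ((C i).2 - O.2)) E1) (eqM ((C i).1 - O.1) E2))).
  by rewrite /sqdist; ring.
move=> j; rewrite -(subrKC i j); move: (j - i) => {}j; move: j.
apply: Zn_ind => [|j IH]; first by rewrite addr0.
by rewrite addrA h h' IH ea eb.
Qed.

(** A line meets a circle in at most two points: otherwise [X] is orthogonal
    to two independent chords. *)
Lemma three_on_circle O S p q r X :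
    sqdist p O = S -> sqdist q O = S -> sqdist r O = S ->
    p <> q -> p <> r -> q <> r -> dot X p = dot X q -> dot X p = dot X r ->
  X = (0, 0).
Proof.
move=> hp hq hr npq npr nqr hXq hXr.
pose x := vec p q; pose y := vec p r.
have x0 : dot X x = 0.
  by apply: (eq_comb (eqM (-1) hXq)); rewrite /dot /x /vec /=; ring.
have y0 : dot X y = 0.
  by apply: (eq_comb (eqM (-1) hXr)); rewrite /dot /y /vec /=; ring.
case: (eqVneq (cross x y) 0) => [xy0|xy0]; last first.
  apply: plane_eq => /=; apply: (mulfI xy0); rewrite mulr0.
    by apply: (eq_comb (eqD (eqM y.2 x0) (eqM (- x.2) y0)));
      rewrite /dot /cross; ring.
  by apply: (eq_comb (eqD (eqM x.1 y0) (eqM (- y.1) x0)));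
    rewrite /dot /cross; ring.
have xx0 : dot x x != 0.
  have := sqdist_neq0 npq; congr (_ != _).
  by rewrite /sqdist /dot /x /vec /=; ring.
have yy0 : dot y y != 0.
  have := sqdist_neq0 npr; congr (_ != _).
  by rewrite /sqdist /dot /y /vec /=; ring.
have mx : 2 * dot (vec O p) x + dot x x = 0.
  apply: (eq_comb (eqD hq (eqM (-1) hp))).
  by rewrite /sqdist /dot /x /vec /=; ring.
have my : 2 * dot (vec O p) y + dot y y = 0.
  apply: (eq_comb (eqD hr (eqM (-1) hp))).
  by rewrite /sqdist /dot /y /vec /=; ring.
pose m := vec O p.
have e1 : dot x x = dot x y.
  apply: (mulIf yy0).
  apply: (eq_comb (eqD (eqM (dot y y) mx) (eqD (eqM (- dot x y) my)
    (eqM (- 2 * (m.1 * y.2 - m.2 * y.1)) xy0)))).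
  by rewrite /m /dot /cross; ring.
have e2 : dot y y = dot x y.
  apply: (mulIf xx0).
  apply: (eq_comb (eqD (eqM (dot x x) my) (eqD (eqM (- dot x y) mx)
    (eqM (2 * (m.1 * x.2 - m.2 * x.1)) xy0)))).
  by rewrite /m /dot /cross; ring.
case: nqr; apply: sqdist_eq0.
apply: (eq_comb (eqD e1 e2)); rewrite /sqdist /dot /x /y /vec /=; ring.
Qed.

(** A circle that does not lie in the annulus goes around the inner circle;
    its successor can then neither go around it as well nor lie in the
    annulus, because in the latter case the contact point would lie on [l] or
    [m]. *)
Lemma concentric_steiner_chain n l m (k : 'Z_n -> circle R) :
    center l = center m -> steiner_chain l m k ->
  let e := (radius l - radius m) / (radius l + radius m) in
  exists S T, [/\ ring_chain (center l) S T (fun i => center (k i)),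
    [/\ e != 0, e ^+ 2 < 1 & 4 * (e ^+ 2 * S) = T],
    forall i, 4 * radius (k i) ^+ 2 = T,
    (forall i p, tangent_at (k i) l p ->
       p = along (center l) (center (k i)) (1 + e)) /\
    (forall i p, tangent_at (k i) m p ->
       p = along (center l) (center (k i)) (1 - e)) &
    forall i p, tangent_at (k i) (k (i + 1)) p ->
       p = along (center (k i)) (center (k (i + 1))) 2^-1].
Proof.
move=> elm [dis inj tg nx] /=; set e := _ / _.
have l0 := radius_gt0 l; have m0 := radius_gt0 m.
have nlm : radius l != radius m.
  apply/eqP => erad; have [[L /tangent_atP[_ lL _]] _] := tg 0.
  have : (on_circle l `&` on_circle m) L.
    by split=> //; move: lL; rewrite /on_circle /= elm erad.
  by rewrite dis.
have cases i : between l m (k i) \/ around l m (k i).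
  have [[L kL] [M kM]] := tg i; exact: (between_or_around kL kM).
have btw i : between l m (k i).
  case: (cases i) => // ar; have [p [kk nl nm]] := nx i.
  case: (cases (i + 1)) => [bt|/(around_not_tangent ar)/(_ kk)//].
  by case: (between_around_touch elm bt ar (tangent_sym kk)).
have lm0 : radius l + radius m != 0 by rewrite lt0r_neq0 ?addr_gt0.
have rk i : 4 * radius (k i) ^+ 2 = (radius l - radius m) ^+ 2.
  by case: (btw i).
have req i j : radius (k i) = radius (k j).
  apply/eqP; rewrite -(@eqrXn2 _ 2) ?ltW ?radius_gt0 //; apply/eqP.
  by have := rk i; have := rk j; lra.
have heS : e * (radius l + radius m) = radius l - radius m by rewrite /e divfK.
exists (((radius l + radius m) / 2) ^+ 2), ((radius l - radius m) ^+ 2); split.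
- split=> [i|i|i j /= eC].
  + rewrite sqdistC; have [h _] := btw i.
    by apply: (eq_comb (eqM 4^-1 h)); field.
  + have [p [kk _ _]] := nx i; have [ncd _] := tangent_along kk.
    rewrite /= -(rk i).
    case: (tangent_sqdist kk); rewrite -(req i (i + 1)) => h.
      by rewrite h; ring.
    by case: ncd; apply: sqdist_eq0; rewrite h; ring.
  + by apply/inj/circle_eq.
- split.
  + by rewrite mulf_neq0 ?invr_eq0 // subr_eq0.
  + rewrite -(ltr_pM2r (x := (radius l + radius m) ^+ 2));
      last by rewrite exprn_gt0 ?addr_gt0.
    rewrite -exprMn heS mul1r -subr_gt0.
    have -> : (radius l + radius m) ^+ 2 - (radius l - radius m) ^+ 2 =
      4 * (radius l * radius m) by ring.
    by rewrite !mulr_gt0.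
  + by rewrite -heS; field.
- exact: rk.
- by split=> i p; have [[L kL] [M kM]] := tg i => kp;
    [case: (between_along kp kM elm nlm (btw i))
    |case: (between_along kL kp elm nlm (btw i))].
- move=> i p kk; have [t [-> S0 h1 h2]] := tangent_ratio kk.
  rewrite -(req i (i + 1)) -h1 in h2; congr along.
  by have := mulIf (lt0r_neq0 S0) h2; lra.
Qed.

End RingChains.

(** * Inversion *)

Section Inversions.
Variable R : realType.
Implicit Types (c d l m k w : circle R) (p q O z h : plane R) (A E D : R).

Lemma inversion_center w p : p <> center w -> inversion w p <> center w.
Proof.
move=> npw; have S0 := sqdist_neq0 npw.
have W0 : radius w ^+ 2 != 0 by rewrite sqrf_eq0 gt_eqF ?radius_gt0.
have s0 : radius w ^+ 2 / sqdist p (center w) != 0.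
  by rewrite mulf_neq0 ?invr_eq0.
move=> e; apply: npw; have := congr1 fst e; have := congr1 snd e => /= e2 e1.
apply: plane_eq; apply/subr0_eq/(mulfI s0); lra.
Qed.

Lemma sqdist_inversion w p : p <> center w ->
  sqdist (inversion w p) (center w) * sqdist p (center w) = radius w ^+ 4.
Proof.
move=> /sqdist_neq0; set S := sqdist p _ => S0.
have -> : sqdist (inversion w p) (center w) =
  (radius w ^+ 2 / S) ^+ 2 * S by rewrite /S /sqdist /=; ring.
by field.
Qed.

Lemma inversionK w : involutive (inversion w).
Proof.
move=> p; case: (pselect (p = center w)) => [->|npw].
  by apply: plane_eq; rewrite /= !subrr !(mulr0, addr0) subrr mulr0 addr0.
have S0 := sqdist_neq0 npw; have Q0 := sqdist_neq0 (inversion_center npw).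
have e := sqdist_inversion npw.
rewrite {1}/inversion; set Q := sqdist (inversion w p) _ in e Q0 *.
have -> : radius w ^+ 2 / Q = sqdist p (center w) / radius w ^+ 2.
  have W0 : radius w != 0 by rewrite gt_eqF ?radius_gt0.
  apply: (mulIf Q0); rewrite divfK // mulrAC [_ * Q]mulrC e; by field.
have W0 : radius w != 0 by rewrite gt_eqF ?radius_gt0.
by apply: plane_eq => /=; field; rewrite S0 W0.
Qed.

Lemma inversion_inj w : injective (inversion w).
Proof. exact: inv_inj (@inversionK w). Qed.

(** The left-hand side of the equation of a circle ([A <> 0]) or a line
    ([A = 0]), in coordinates with origin [O]. *)
Definition gpower O A h E q : R := A * sqdist q O + 2 * dot h (vec O q) + E.

(** Inversion exchanges the leading and the constant coefficient, up to powers
    of the radius. *)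
Lemma gpower_inversion w A h E p : p <> center w ->
  sqdist (inversion w p) (center w) * gpower (center w) A h E p =
  gpower (center w) E (radius w ^+ 2 * h.1, radius w ^+ 2 * h.2)
    (radius w ^+ 4 * A) (inversion w p).
Proof.
move=> npw; have S0 := sqdist_neq0 npw; have e := sqdist_inversion npw.
rewrite /gpower -e.
have -> : dot (radius w ^+ 2 * h.1, radius w ^+ 2 * h.2)
     (vec (center w) (inversion w p)) =
   (sqdist (inversion w p) (center w) * sqdist p (center w)) /
     sqdist p (center w) * dot h (vec (center w) p).
  by rewrite e /dot /vec /=; field.
by rewrite mulfK //; ring.
Qed.

Lemma power_inversion w z D p : p <> center w ->
  sqdist (inversion w p) (center w) * (sqdist p z - D) =
  gpower (center w) (sqdist z (center w) - D)
    (- radius w ^+ 2 * (z.1 - (center w).1),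
     - radius w ^+ 2 * (z.2 - (center w).2))
    (radius w ^+ 4) (inversion w p).
Proof.
move=> npw.
have -> : sqdist p z - D =
    gpower (center w) 1 (vec z (center w)) (sqdist z (center w) - D) p.
  by rewrite /gpower /sqdist /dot /vec /=; ring.
rewrite gpower_inversion //.
by rewrite /gpower /dot /vec /=; ring.
Qed.

Definition inverts w c c' :=
  forall p, on_circle c p <-> on_circle c' (inversion w p).

Lemma inverts_image w c c' :
  inversion w @` on_circle c = on_circle c' -> inverts w c c'.
Proof.
move=> e p; rewrite -e; split=> [cp|[q cq /inversion_inj <-//]].
by exists p.
Qed.

Lemma inverts_exists w c : ~ on_circle c (center w) ->
  exists c', inverts w c c'.
Proof.
move=> ncw; pose D := sqdist (center c) (center w) - radius c ^+ 2.
have D0 : D != 0.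
  by apply/eqP => /subr0_eq h; apply: ncw; rewrite /on_circle /= -h sqdistC.
have W0 := radius_gt0 w; have r0 := radius_gt0 c.
have W2 : radius w ^+ 2 != 0 by rewrite sqrf_eq0 gt_eqF.
pose s := radius w ^+ 2 / D.
have s0 : s != 0 by rewrite mulf_neq0 ?invr_eq0.
have r'0 : 0 < `|s| * radius c by rewrite mulr_gt0 ?normr_gt0.
pose z := along (center w) (center c) s.
exists (@Circle R z _ r'0) => p.
rewrite /on_circle /= exprMn real_normK ?num_real //.
have key q : sqdist q z - s ^+ 2 * radius c ^+ 2 =
    D^-1 * gpower (center w) D
    (- radius w ^+ 2 * ((center c).1 - (center w).1),
     - radius w ^+ 2 * ((center c).2 - (center w).2)) (radius w ^+ 4) q.
  have hr : radius c ^+ 2 = sqdist (center c) (center w) - D.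
    by rewrite /D; ring.
  by rewrite hr /gpower /s /z /sqdist /dot /vec /= /s; field.
case: (pselect (p = center w)) => [->|npw].
  split=> [//|]; rewrite (_ : inversion w _ = center w); last first.
    by apply: plane_eq => /=; ring.
  move/eqP; rewrite -subr_eq0 key /gpower /dot /sqdist /=.
  rewrite (_ : _ + _ = radius w ^+ 4); last by ring.
  by rewrite mulf_eq0 invr_eq0 (negPf D0) expf_eq0 gt_eqF.
have Q0 := sqdist_neq0 (inversion_center npw).
have hp := power_inversion (center c) (radius c ^+ 2) npw.
split=> [cp|/eqP].
  by apply/subr0_eq; rewrite key -hp cp subrr !mulr0.
rewrite -subr_eq0 key -hp mulf_eq0 invr_eq0 (negPf D0) mulf_eq0 (negPf Q0) /=.
by rewrite subr_eq0 => /eqP.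
Qed.

(** The inverse of a circle through the centre of inversion contains a line:
    the points [q t].  The squared distance from a fixed point is a quadratic
    polynomial in [t] with leading coefficient [|v|^2], so it is not constant.
    *)
Lemma inverts_center w c c' : inverts w c c' -> ~ on_circle c (center w).
Proof.
move=> inv cw; have r0 := radius_gt0 c.
pose v := vec (center w) (center c).
have vv : dot v v = radius c ^+ 2.
  by rewrite -cw /dot /v /vec /sqdist /=; ring.
have v0 : dot v v != 0 by rewrite vv sqrf_eq0 gt_eqF.
have W0 := radius_gt0 w.
pose s := radius w ^+ 2 / (2 * dot v v).
pose q t : plane R := ((center w).1 + s * v.1 - t * v.2,
                       (center w).2 + s * v.2 + t * v.1).
have qc' t : on_circle c' (q t).
  have nq : q t <> center w.
    move=> e; have := congr1 fst e; have := congr1 snd e.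
    rewrite /q /v /= => e2 e1.
    have : s * dot v v = 0.
      have E1 : s * v.1 - t * v.2 = 0 by rewrite /v /=; lra.
      have E2 : s * v.2 + t * v.1 = 0 by rewrite /v /=; lra.
      by apply: (eq_comb (eqD (eqM v.1 E1) (eqM v.2 E2))); rewrite /dot; ring.
    move/eqP; rewrite mulf_eq0 (negPf v0) orbF mulf_eq0 invr_eq0.
    by rewrite sqrf_eq0 gt_eqF // mulf_eq0 (negPf v0) pnatr_eq0.
  have Q0 := sqdist_neq0 nq.
  rewrite -(inversionK w (q t)); apply/(inv _).1.
  have := power_inversion (center c) (radius c ^+ 2) (inversion_center nq).
  rewrite inversionK (_ : gpower _ _ _ _ _ = 0).
    by move/eqP; rewrite mulf_eq0 (negPf Q0) /= subr_eq0 => /eqP.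
  have es : s * (2 * dot v v) = radius w ^+ 2.
    by rewrite /s divfK // mulf_neq0 ?pnatr_eq0.
  rewrite /gpower -cw sqdistC subrr mul0r add0r.
  have -> : radius w ^+ 4 = radius w ^+ 2 * (s * (2 * dot v v)).
    by rewrite es; ring.
  by rewrite /dot /q /vec /v /vec /=; ring.
have h0 := qc' 0; have h1 := qc' 1; have h2 := qc' (-1).
have : 2 * dot v v = 0.
  apply: (eq_comb (eqD h1 (eqD h2 (eqM (-2) h0)))).
  by rewrite /q /sqdist /dot /=; ring.
by move/eqP; rewrite mulf_eq0 (negPf v0) pnatr_eq0.
Qed.

End Inversions.

(** * Inverting a Steiner chain *)

Section InvertedChains.
Variable R : realType.
Implicit Types (c d l m k w : circle R) (p q O z h : plane R) (A E D : R).

Lemma inverts_fun w c c' d' : inverts w c c' -> inverts w c d' -> c' = d'.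
Proof.
move=> ic id; apply: circle_ext => p.
by rewrite -(inversionK w p); split=> [/ic|/id] cp; [apply/id|apply/ic].
Qed.

Lemma inverts_inj w c d c' : inverts w c c' -> inverts w d c' -> c = d.
Proof.
move=> ic id; apply: circle_ext => p.
by split=> [/ic|/id] cp; [apply/id|apply/ic].
Qed.

Lemma tangent_inverts w c c' d d' p : inverts w c c' -> inverts w d d' ->
  tangent_at c d p -> tangent_at c' d' (inversion w p).
Proof.
move=> ic id /tangent_atP[cp dp uniq]; apply/seteqP; split=> q /=.
  rewrite -{1 2}(inversionK w q) => -[/ic cq /id dq].
  by rewrite -(uniq _ cq dq) inversionK.
by move=> ->; split; [apply/ic|apply/id].
Qed.

(** If [k] passes through the centre of inversion, its inverse is a line, and
    this line meets the circle [l'] only in the image of [L].  Reflecting this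
    image in the perpendicular dropped from the centre of [l'] gives a common
    point again, so the image of [L] is the foot of the perpendicular. *)
Lemma tangent_line_foot w k l l' L : on_circle k (center w) ->
    inverts w l l' -> tangent_at k l L ->
  let v := vec (center w) (center k) in
  2 * dot v (vec (center w) (inversion w L)) = radius w ^+ 2 /\
  cross v (vec (center l') (inversion w L)) = 0.
Proof.
move=> kw il /tangent_atP[kL lL uniq] v.
have nLw : L <> center w by move=> e; apply: (inverts_center il); rewrite -e.
have W0 := radius_gt0 w; have r0 := radius_gt0 k.
have W2 : radius w ^+ 2 != 0 by rewrite sqrf_eq0 gt_eqF.
have vv : dot v v = radius k ^+ 2.
  by rewrite -kw /dot /v /vec /sqdist /=; ring.
have v0 : dot v v != 0 by rewrite vv sqrf_eq0 gt_eqF.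
have pw p : p <> center w ->
  sqdist (inversion w p) (center w) * (sqdist p (center k) - radius k ^+ 2) =
  radius w ^+ 2 *
    (radius w ^+ 2 - 2 * dot v (vec (center w) (inversion w p))).
  move=> npw; rewrite power_inversion // /gpower -kw sqdistC subrr.
  by rewrite /dot /v /vec /=; ring.
have eL : 2 * dot v (vec (center w) (inversion w L)) = radius w ^+ 2.
  have := pw L nLw; rewrite kL subrr mulr0 => /esym/eqP.
  by rewrite mulf_eq0 (negPf W2) /= subr_eq0 => /eqP.
split=> //.
pose x := vec (center l') (inversion w L).
pose t := - 2 * cross v x / dot v v.
have tv : t * dot v v = - 2 * cross v x by rewrite /t divfK.
pose q : plane R :=
  ((inversion w L).1 - t * v.2, (inversion w L).2 + t * v.1).
have eq' : 2 * dot v (vec (center w) q) = radius w ^+ 2.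
  by rewrite -eL /dot /q /vec /=; ring.
have nq : q <> center w.
  move=> e; move: W2; rewrite -eq' e /dot /vec /=.
  by rewrite (_ : 2 * _ = 0) ?eqxx //; ring.
have lq : on_circle l' q.
  have : on_circle l' (inversion w L) by apply/il.
  rewrite /on_circle /= => <-; apply: (eq_comb (eqM t tv)).
  by rewrite /q /sqdist /cross /dot /x /vec /=; ring.
have eqL : inversion w q = L.
  apply: uniq; last by apply/il; rewrite inversionK.
  have := pw _ (inversion_center nq); rewrite inversionK eq' subrr mulr0.
  by move/eqP; rewrite mulf_eq0 (negPf (sqdist_neq0 nq)) /= subr_eq0 => /eqP.
have {eqL}eqL : q = inversion w L by rewrite -eqL inversionK.
have h1 : (inversion w L).1 - t * v.2 = (inversion w L).1 := congr1 fst eqL.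
have h2 : (inversion w L).2 + t * v.1 = (inversion w L).2 := congr1 snd eqL.
have E1 : t * v.2 = 0 by lra.
have E2 : t * v.1 = 0 by lra.
have : - 2 * cross v x = 0.
  by rewrite -tv; apply: (eq_comb (eqD (eqM v.2 E1) (eqM v.1 E2)));
    rewrite /dot; ring.
by rewrite -/x; lra.
Qed.

(** Otherwise the two contact points would have the same image, the foot of
    the perpendicular from the common centre to a line. *)
Lemma tangent_avoids_center w k l l' m m' L M :
    inverts w l l' -> inverts w m m' -> center l' = center m' ->
    on_circle l `&` on_circle m = set0 ->
    tangent_at k l L -> tangent_at k m M ->
  ~ on_circle k (center w).
Proof.
move=> il im ec dis kl km kw.
have [e1 e2] := tangent_line_foot kw il kl.
have [e3 e4] := tangent_line_foot kw im km.
have [_ lL _] := tangent_atP kl; have [_ mM _] := tangent_atP km.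
pose v := vec (center w) (center k); rewrite -/v in e1 e2 e3 e4.
have v0 : dot v v != 0.
  have := radius_gt0 k; rewrite lt0r => /andP[+ _]; rewrite -sqrf_eq0 -kw.
  by congr (_ != _); rewrite /v /dot /vec /sqdist /=; ring.
rewrite -ec in e4.
have eLM : inversion w L = inversion w M.
  move: (inversion w L) (inversion w M) e1 e2 e3 e4 => p q e1 e2 e3 e4.
  apply: plane_eq; apply: (mulfI v0).
    apply: (eq_comb (eqD (eqM (v.1 / 2) e1) (eqD (eqM (- v.1 / 2) e3)
      (eqD (eqM (- v.2) e2) (eqM v.2 e4))))).
    by rewrite /dot /cross /vec /=; field.
  apply: (eq_comb (eqD (eqM (v.2 / 2) e1) (eqD (eqM (- v.2 / 2) e3)
    (eqD (eqM (v.1) e2) (eqM (- v.1) e4))))).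
  by rewrite /dot /cross /vec /=; field.
have : (on_circle l `&` on_circle m) L.
  by split=> //; rewrite (inversion_inj eLM).
by rewrite dis.
Qed.

(** Every condition on a chain speaks of intersections of circles, and
    inversion is a bijection of the plane; it remains to know that the circles
    of the chain do not become lines. *)
Lemma steiner_chain_inverts n w l l' m m' (k : 'Z_n -> circle R) :
    inverts w l l' -> inverts w m m' -> center l' = center m' ->
    steiner_chain l m k ->
  exists k' : 'Z_n -> circle R,
    (forall i, inverts w (k i) (k' i)) /\ steiner_chain l' m' k'.
Proof.
move=> il im ec [dis inj tg nx].
have /boolp.choice[kk ik] : forall i, exists c', inverts w (k i) c'.
  move=> i; have [[L kL] [M kM]] := tg i.
  exact/inverts_exists/(tangent_avoids_center il im ec dis kL kM).
exists kk; split=> //; split.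
- apply/seteqP; split=> [q|//]; rewrite -(inversionK w q) => -[/il lq /im mq].
  by have : (on_circle l `&` on_circle m) (inversion w q) by []; rewrite dis.
- move=> i j e; apply/inj/(inverts_inj (ik i)); rewrite e; exact: ik.
- move=> i; have [[L kL] [M kM]] := tg i.
  by split; eexists; apply: tangent_inverts; eauto.
- move=> i; have [p [kp nl nm]] := nx i; exists (inversion w p); split.
  + exact: tangent_inverts kp.
  + by move/il.
  + by move/im.
Qed.

Lemma gpower_rebase O z A h E q : gpower z A h E q =
  gpower O A (h.1 + A * (O.1 - z.1), h.2 + A * (O.2 - z.2))
    (gpower z A h E O) q.
Proof. by rewrite /gpower /sqdist /dot /vec /=; ring. Qed.

Lemma concyclic_inversion w O p q r s : p <> center w -> q <> center w ->
    r <> center w -> s <> center w -> concyclic p q r s ->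
  exists A h E, ~ [/\ A = 0, h = (0, 0) & E = 0] /\
   [/\ gpower O A h E (inversion w p) = 0, gpower O A h E (inversion w q) = 0,
       gpower O A h E (inversion w r) = 0 & gpower O A h E (inversion w s) = 0].
Proof.
move=> np nq nr ns cyc.
have [A [h [E [nz [hp hq hr hs]]]]] : exists A h E,
    ~ [/\ A = 0, h = (0, 0) & E = 0] /\
    [/\ gpower (center w) A h E p = 0, gpower (center w) A h E q = 0,
        gpower (center w) A h E r = 0 & gpower (center w) A h E s = 0].
  case: cyc => [[c [cp cq cr cs]]|[a [b [c [ab [lp lq lr ls]]]]]].
    exists 1, (vec (center c) (center w)),
      (sqdist (center c) (center w) - radius c ^+ 2).
    split; first by case=> /eqP; rewrite oner_eq0.
    have key x : on_circle c x ->
      gpower (center w) 1 (vec (center c) (center w))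
      (sqdist (center c) (center w) - radius c ^+ 2) x = 0.
      by move=> <-; rewrite /gpower /sqdist /dot /vec /=; ring.
    by split; apply: key.
  exists 0, (a / 2, b / 2), (a * (center w).1 + b * (center w).2 + c); split.
    case=> _ h _; apply: ab.
    have := congr1 fst h; have := congr1 snd h => /= h2 h1.
    by congr pair; lra.
  have key x : line a b c x -> gpower (center w) 0 (a / 2, b / 2)
     (a * (center w).1 + b * (center w).2 + c) x = 0.
    move=> e; apply: (eq_comb e).
    by rewrite /gpower /sqdist /dot /vec /=; field.
  by split; apply: key.
set W := radius w ^+ 2.
exists E, (W * h.1 + E * (O.1 - (center w).1),
           W * h.2 + E * (O.2 - (center w).2)).
exists (gpower (center w) E (W * h.1, W * h.2) (radius w ^+ 4 * A) O).
have W0 : W != 0 by rewrite sqrf_eq0 gt_eqF ?radius_gt0.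
split.
  case=> E0 hW fO; apply: nz; have := congr1 fst hW; have := congr1 snd hW.
  rewrite /= E0 !(mul0r, addr0) => /eqP.
  rewrite mulf_eq0 (negPf W0) /= => /eqP h2.
  move=> /eqP; rewrite mulf_eq0 (negPf W0) /= => /eqP h1.
  split=> //; last exact: plane_eq.
  move: fO; rewrite /gpower E0 h1 h2 /dot /= !(mul0r, mulr0, add0r, addr0).
  by move/eqP; rewrite mulf_eq0 expf_eq0 gt_eqF ?radius_gt0 //= => /eqP.
have key x : x <> center w -> gpower (center w) A h E x = 0 ->
    gpower O E (W * h.1 + E * (O.1 - (center w).1),
                W * h.2 + E * (O.2 - (center w).2))
      (gpower (center w) E (W * h.1, W * h.2) (radius w ^+ 4 * A) O)
      (inversion w x) = 0.
  move=> nx hx; have := gpower_inversion A h E nx.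
  by rewrite hx mulr0 (gpower_rebase O) => <-.
by split; apply: key.
Qed.

End InvertedChains.

(** * The two concentric chains coincide or are mirror images *)

Section Dichotomy.
Variable R : realType.
Implicit Types (p q O h nrm : plane R) (A E D S T e d : R).

Definition refl nrm d q : plane R :=
  (q.1 - 2 * (dot nrm q - d) * nrm.1, q.2 - 2 * (dot nrm q - d) * nrm.2).

Lemma sqdist_refl nrm d p q : dot nrm nrm = 1 ->
  sqdist (refl nrm d p) (refl nrm d q) = sqdist p q.
Proof.
move=> n1; pose y := dot nrm (vec q p).
apply: (eq_comb (eqM (4 * y ^+ 2) n1)).
by rewrite /y /refl /sqdist /dot /vec /=; ring.
Qed.

Lemma along_refl nrm d O C t :
  along (refl nrm d O) (refl nrm d C) t = refl nrm d (along O C t).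
Proof. by apply: plane_eq; rewrite /refl /along /dot /=; ring. Qed.

Lemma refl_inj nrm d : dot nrm nrm = 1 -> injective (refl nrm d).
Proof.
move=> n1 p q e; apply: sqdist_eq0.
by rewrite -(sqdist_refl d _ _ n1) e /sqdist; ring.
Qed.

Lemma ring_chain_refl n nrm d O S T (C : 'Z_n -> plane R) : dot nrm nrm = 1 ->
  ring_chain O S T C ->
  ring_chain (refl nrm d O) S T (fun i => refl nrm d (C i)).
Proof.
move=> n1 [hS hT inj]; split=> [i|i|i j /(refl_inj n1)/inj//].
- by rewrite sqdist_refl.
- by rewrite sqdist_refl.
Qed.

(** Let [h] be the coefficient vector of the equation of the given circle or
    line with origin [K], a point of both rings.  Since [L] and [M] are
    symmetric about the centre of their circle, the sum and the difference of
    the equations at these points involve [h] only through [h .  c] and [h .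
    o], and give the same values for both chains.  So [h] is orthogonal to [c1
    - c2] and to [o1 - o2], and these vectors are parallel.  As [c1] and [c2]
    have the same distance from [K], the perpendicular bisector of [c1 c2]
    passes through [K], and it is the axis of the reflection. *)
Lemma reflected_step K o1 o2 c1 c2 S1 S2 T e1 e2 A h E :
    0 < T -> c1 <> c2 ->
    sqdist K o1 = S1 -> sqdist c1 o1 = S1 -> sqdist K c1 = T ->
    sqdist K o2 = S2 -> sqdist c2 o2 = S2 -> sqdist K c2 = T ->
    e1 != 0 -> 4 * (e1 ^+ 2 * S1) = T -> e2 != 0 -> 4 * (e2 ^+ 2 * S2) = T ->
    ~ [/\ A = 0, h = (0, 0) & E = 0] ->
    gpower K A h E (along o1 c1 (1 + e1)) = 0 ->
    gpower K A h E (along o1 c1 (1 - e1)) = 0 ->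
    gpower K A h E (along o2 c2 (1 + e2)) = 0 ->
    gpower K A h E (along o2 c2 (1 - e2)) = 0 ->
  exists nrm d, [/\ dot nrm nrm = 1, dot nrm K = d,
                    c2 = refl nrm d c1 & o2 = refl nrm d o1].
Proof.
move=> T0 nc Ko1 co1 Kc1 Ko2 co2 Kc2 e10 eS1 e20 eS2 nz f1p f1m f2p f2m.
have step o c S e : sqdist K o = S -> sqdist c o = S -> sqdist K c = T ->
    e != 0 -> 4 * (e ^+ 2 * S) = T ->
    gpower K A h E (along o c (1 + e)) = 0 ->
    gpower K A h E (along o c (1 - e)) = 0 ->
    [/\ dot (vec K c) (vec K o) = T / 2,
        2 * dot h (vec K c) + 5 / 4 * A * T + E = 0 &
        A * T / 2 + dot h (vec K c) = dot h (vec K o)].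
  move=> Ko co Kc e0 eS fp fm.
  have cok : dot (vec K c) (vec K o) = T / 2.
    apply: (eq_comb (eqD (eqM 2^-1 (eqD Kc Ko)) (eqM (- 2^-1) co))).
    by rewrite /dot /vec /sqdist /=; field.
  split=> //.
    apply: (eq_comb (eqD (eqM 2^-1 (eqD fp fm)) (eqD (eqM (- A) Kc)
       (eqD (eqM (- A / 4) eS) (eqM (- A * e ^+ 2) co))))).
    by rewrite /gpower /along /dot /vec /sqdist /=; field.
  apply: (mulfI e0).
  apply: (eq_comb (eqD (eqM 4^-1 (eqD fp (eqM (-1) fm))) (eqD (eqM (- A * e) Kc)
       (eqM (A * e) cok)))).
  by rewrite /gpower /along /dot /vec /sqdist /=; field.
have [co1' hc1 ho1] := step _ _ _ _ Ko1 co1 Kc1 e10 eS1 f1p f1m.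
have [co2' hc2 ho2] := step _ _ _ _ Ko2 co2 Kc2 e20 eS2 f2p f2m.
pose g := vec c2 c1; pose y := vec o2 o1.
have hg : dot h g = 0.
  by apply: (eq_comb (eqM 2^-1 (eqD hc1 (eqM (-1) hc2))));
    rewrite /dot /vec /=; field.
have hy : dot h y = 0.
  apply: (eq_comb (eqD hg (eqD ho2 (eqM (-1) ho1)))).
  by rewrite /dot /g /y /vec /=; ring.
have yg : cross y g = 0.
  case: (eqVneq (cross y g) 0) => // yg0; case: nz.
  have h1 : h.1 = 0.
    apply: (mulfI yg0); rewrite mulr0.
    by apply: (eq_comb (eqD (eqM g.2 hy) (eqM (- y.2) hg)));
      rewrite /dot /cross; ring.
  have h2 : h.2 = 0.
    apply: (mulfI yg0); rewrite mulr0.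
    by apply: (eq_comb (eqD (eqM y.1 hg) (eqM (- g.1) hy)));
      rewrite /dot /cross; ring.
  have A0 : A = 0.
    apply: (mulIf (lt0r_neq0 T0)); move: ho1; rewrite /dot h1 h2; lra.
  split=> //; first exact: plane_eq.
  by move: hc1; rewrite /dot h1 h2 A0; lra.
pose G := dot g g.
have G0 : 0 < G.
  exact: sqdist_gt0 nc.
have gc : 2 * dot g (vec K c1) = G.
  apply: (eq_comb (eqD Kc1 (eqM (-1) Kc2))).
  by rewrite /G /g /dot /sqdist /vec /=; ring.
have go : 2 * dot g (vec K o1) = dot y g.
  apply: (mulfI (lt0r_neq0 G0)).
  pose f : plane R := (c1.1 + c2.1 - 2 * K.1, c1.2 + c2.2 - 2 * K.2).
  have gf : dot g f = 0.
    apply: (eq_comb (eqD Kc1 (eqM (-1) Kc2))).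
    by rewrite /g /f /dot /sqdist /vec /=; ring.
  apply: (eq_comb (eqD (eqM (- dot y g) gf)
    (eqD (eqM (- (f.1 * g.2 - f.2 * g.1)) yg)
     (eqM (2 * G) (eqD co1' (eqM (-1) co2')))))).
  by rewrite /G /f /y /g /cross /dot /vec /=; ring.
have sG : Num.sqrt G * Num.sqrt G = G by rewrite -expr2 sqr_sqrtr // ltW.
have s0 : Num.sqrt G != 0 by rewrite sqrtr_eq0 -ltNge.
pose nrm : plane R := (g.1 / Num.sqrt G, g.2 / Num.sqrt G).
have reflE q : refl nrm (dot nrm K) q =
    (q.1 - 2 * dot g (vec K q) / G * g.1, q.2 - 2 * dot g (vec K q) / G * g.2).
  by rewrite -sG; apply: plane_eq; rewrite /refl /nrm /dot /vec /=; field.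
have Gn := lt0r_neq0 G0.
exists nrm, (dot nrm K); split=> //.
- have -> : dot nrm nrm = G / (Num.sqrt G * Num.sqrt G).
    by rewrite /nrm /G /dot /=; field.
  by rewrite sG divff.
- by rewrite reflE gc divff // /g /vec /=; apply: plane_eq => /=; ring.
- have kG : dot y g / G * G = dot y g by rewrite divfK.
  rewrite reflE go; apply: plane_eq => /=; apply: (mulfI Gn).
    apply: (eq_comb (eqD (eqM (- g.2) yg) (eqM g.1 kG))).
    by rewrite /G /y /cross /dot /vec /=; ring.
  apply: (eq_comb (eqD (eqM g.1 yg) (eqM g.2 kG))).
  by rewrite /G /y /cross /dot /vec /=; ring.
Qed.

(** Apply [reflected_step] to the two neighbours of the common circle.  If it
    applies to neither, the chains share three consecutive centres, and both
    rings are the circle through these. *)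
Lemma same_or_reflected n O1 S1 O2 S2 T e1 e2 (C1 C2 : 'Z_n -> plane R) :
    (2 < n)%N -> ring_chain O1 S1 T C1 -> ring_chain O2 S2 T C2 ->
    C1 1 = C2 1 ->
    e1 != 0 -> 4 * (e1 ^+ 2 * S1) = T -> e2 != 0 -> 4 * (e2 ^+ 2 * S2) = T ->
    (forall i, exists A h E, ~ [/\ A = 0, h = (0, 0) & E = 0] /\
      [/\ gpower (C1 1) A h E (along O1 (C1 i) (1 + e1)) = 0,
          gpower (C1 1) A h E (along O1 (C1 i) (1 - e1)) = 0,
          gpower (C1 1) A h E (along O2 (C2 i) (1 + e2)) = 0 &
          gpower (C1 1) A h E (along O2 (C2 i) (1 - e2)) = 0]) ->
  (O1 = O2 /\ C1 =1 C2) \/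
  exists nrm d, [/\ dot nrm nrm = 1, dot nrm (C1 1) = d, O2 = refl nrm d O1 &
                    forall i, C2 i = refl nrm d (C1 i)].
Proof.
move=> n2 ch1 ch2 common e10 eS1 e20 eS2 cyc.
have [hS1 hT1 inj1] := ch1; have [hS2 hT2 inj2] := ch2.
have T0 : 0 < T.
  rewrite -eS1 mulr_gt0 // mulr_gt0 ?(ring_chain_gt0 ch1) //.
  by rewrite lt0r sqrf_eq0 e10 sqr_ge0.
have fixK nrm d : dot nrm (C1 1) = d -> refl nrm d (C1 1) = C1 1.
  by move=> hd; apply: plane_eq; rewrite /refl hd /=; ring.
case: (pselect (C1 (1 + 1) = C2 (1 + 1))) => [e2'|ne]; last first.
  right; have [A [h [E [nz [f1 f2 f3 f4]]]]] := cyc (1 + 1).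
  have t2 : sqdist (C1 1) (C2 (1 + 1)) = T by rewrite common.
  have s2 : sqdist (C1 1) O2 = S2 by rewrite common.
  have [nrm [d [n1 nd ec eo]]] := reflected_step T0 ne (hS1 1) (hS1 (1 + 1))
    (hT1 1) s2 (hS2 (1 + 1)) t2 e10 eS1 e20 eS2 nz f1 f2 f3 f4.
  exists nrm, d; split=> //; apply: (ring_chain_unique n2 (i := 1) ch2).
  - by rewrite eo; apply: ring_chain_refl n1 ch1.
  - by rewrite fixK.
  - exact: ec.
have e01 : 0 + 1 = 1 :> 'Z_n by rewrite add0r.
case: (pselect (C1 0 = C2 0)) => [e0'|ne]; last first.
  right; have [A [h [E [nz [f1 f2 f3 f4]]]]] := cyc 0.
  have t1 : sqdist (C1 1) (C1 0) = T by rewrite sqdistC -e01.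
  have t2 : sqdist (C1 1) (C2 0) = T by rewrite common sqdistC -e01.
  have s2 : sqdist (C1 1) O2 = S2 by rewrite common.
  have [nrm [d [n1 nd ec eo]]] := reflected_step T0 ne (hS1 1) (hS1 0)
    t1 s2 (hS2 0) t2 e10 eS1 e20 eS2 nz f1 f2 f3 f4.
  exists nrm, d; split=> //; apply: (ring_chain_unique n2 (i := 0) ch2).
  - by rewrite eo; apply: ring_chain_refl n1 ch1.
  - exact: ec.
  - by rewrite e01 fixK.
left; have n20 : (1 + 1 : 'Z_n) != 0 by rewrite -(natrD _ 1 1) natr_Zn_neq0.
have d01 : C1 0 <> C1 1 by move/inj1/eqP; rewrite eq_sym oner_eq0.
have d02 : C1 0 <> C1 (1 + 1) by move/inj1/eqP; rewrite eq_sym (negPf n20).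
have d12 : C1 1 <> C1 (1 + 1).
  by move/inj1; rewrite -[LHS]addr0 => /addrI/eqP; rewrite eq_sym oner_eq0.
have eq2 i : C1 i = C2 i -> 2 * dot (vec O1 O2) (C1 i) =
   S1 - S2 + dot O2 O2 - dot O1 O1.
  move=> e; have := hS2 i; rewrite -e => h; have h' := hS1 i.
  apply: (eq_comb (eqD h' (eqM (-1) h))).
  by rewrite /dot /vec /sqdist /=; ring.
have r0 := eq2 _ e0'; have r1 := eq2 _ common; have r2 := eq2 _ e2'.
have : vec O1 O2 = (0, 0).
  by apply: (three_on_circle (hS1 0) (hS1 1) (hS1 (1 + 1))) => //; lra.
move=> /[dup] /(congr1 fst) /= v1 /(congr1 snd) /= v2.
have eO : O1 = O2 by apply: plane_eq; lra.
split=> //; apply: (ring_chain_unique n2 (i := 1) ch1) => //.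
by rewrite eO.
Qed.

End Dichotomy.

(** * Conics of centres *)

Section Conics.
Variable R : realType.
Implicit Types (c w : circle R) (p q z v o O C h nrm : plane R).
Implicit Types (A E D S T t s d : R) (f g : plane R -> R) (H : set (plane R)).

(** Conics are found by elimination, and these two predicates spare the
    expansion of the resulting equations into coefficients. *)
Definition affine_fun f :=
  exists a b c : R, forall p, f p = a * p.1 + b * p.2 + c.

Definition quadratic_fun f := exists a b c d e g : R, forall p,
  f p = a * p.1 ^+ 2 + b * (p.1 * p.2) + c * p.2 ^+ 2 + d * p.1 + e * p.2 + g.

Lemma affine_funI f :
  (forall p, f p = (f (1, 0) - f (0, 0)) * p.1 + (f (0, 1) - f (0, 0)) * p.2
                   + f (0, 0)) -> affine_fun f.
Proof. by move=> h; do 3 eexists; exact: h. Qed.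

Lemma quadratic_mul f g : affine_fun f -> affine_fun g ->
  quadratic_fun (fun p => f p * g p).
Proof.
move=> [a [b [c hf]]] [a' [b' [c' hg]]].
exists (a * a'), (a * b' + b * a'), (b * b'), (a * c' + c * a').
by exists (b * c' + c * b'), (c * c') => p; rewrite hf hg; ring.
Qed.

Lemma quadratic_sqr f : affine_fun f -> quadratic_fun (fun p => f p ^+ 2).
Proof.
move=> af; have [a [b [c [d [e [m h]]]]]] := quadratic_mul af af.
by exists a, b, c, d, e, m => p; rewrite expr2 h.
Qed.

Lemma quadratic_lin f g (k : R) : quadratic_fun f -> quadratic_fun g ->
  quadratic_fun (fun p => f p + k * g p).
Proof.
move=> [a [b [c [d [e [m hf]]]]]] [a' [b' [c' [d' [e' [m' hg]]]]]].
exists (a + k * a'), (b + k * b'), (c + k * c'), (d + k * d').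
by exists (e + k * e'), (m + k * m') => p; rewrite hf hg; ring.
Qed.

Lemma affine_quadratic f : affine_fun f -> quadratic_fun f.
Proof.
by move=> [a [b [c h]]]; exists 0, 0, 0, a, b, c => p; rewrite h; ring.
Qed.

(** If the quadratic part of [f] vanishes, the zeros form a line, which is a
    double line, or the empty set. *)
Lemma conic_cover f z : quadratic_fun f -> f z != 0 ->
  exists H, conic H /\ forall p, f p = 0 -> H p.
Proof.
move=> [a [b [c [d [e [m hf]]]]]] fz.
case: (pselect ((a, b, c) = (0, 0, 0))) => [[a0 b0 c0]|nz]; last first.
  exists [set p | f p = 0]; split=> //; exists a, b, c, d, e, m; split=> //.
  by apply/seteqP; split=> p /=; rewrite hf.
case: (pselect ((d, e) = (0, 0))) => [[d0 e0]|nz].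
  exists [set p | 1 * p.1 ^+ 2 + 0 * (p.1 * p.2) + 0 * p.2 ^+ 2
                 + 0 * p.1 + 0 * p.2 + 0 = 0].
  split; first by exists 1, 0, 0, 0, 0, 0; split=> // -[/eqP]; rewrite oner_eq0.
  move=> p fp; case/eqP: fz; rewrite -fp !hf a0 b0 c0 d0 e0; ring.
exists [set p | d ^+ 2 * p.1 ^+ 2 + 2 * d * e * (p.1 * p.2) + e ^+ 2 * p.2 ^+ 2
                 + 2 * d * m * p.1 + 2 * e * m * p.2 + m ^+ 2 = 0].
split.
  exists (d ^+ 2), (2 * d * e), (e ^+ 2), (2 * d * m), (2 * e * m), (m ^+ 2).
  split=> // -[/eqP + _ /eqP]; rewrite !sqrf_eq0 => /eqP d0 /eqP e0.
  by apply: nz; rewrite d0 e0.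
move=> p fp /=; have : f p * f p = 0 by rewrite fp mulr0.
by move=> e0; apply: (eq_comb e0); rewrite hf a0 b0 c0; ring.
Qed.

(** Two parallel lines: the line [p q] and its parallel through [z]. *)
Lemma conic_through3 p q z : exists H, conic H /\ [/\ H p, H q & H z].
Proof.
have [g [g0 gpq]] : exists g : plane R, g <> (0, 0) /\ dot g p = dot g q.
  case: (pselect (p = q)) => [->|npq].
    by exists (1, 0); split=> // -[/eqP]; rewrite oner_eq0.
  exists (p.2 - q.2, q.1 - p.1); split; last by rewrite /dot /=; ring.
  by case=> e2 e1; apply: npq; apply: plane_eq; lra.
pose u := dot g p; pose v := dot g z.
exists [set x | g.1 ^+ 2 * x.1 ^+ 2 + 2 * g.1 * g.2 * (x.1 * x.2)
  + g.2 ^+ 2 * x.2 ^+ 2 + - (u + v) * g.1 * x.1 + - (u + v) * g.2 * x.2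
  + u * v = 0].
split.
  do 6 eexists; split; last by [].
  move=> [/eqP + _ /eqP]; rewrite !sqrf_eq0 => /eqP g1 /eqP g2.
  by apply/g0/plane_eq.
by split; rewrite /= /v /u; [|rewrite gpq|]; rewrite /dot; ring.
Qed.

Section InvertedCircles.
Variables (w : circle R) (O : plane R).
Local Notation W := (radius w ^+ 2).
Local Notation J := (inversion w).

Let W0 : W != 0.
Proof. by rewrite sqrf_eq0 gt_eqF ?radius_gt0. Qed.

Definition inverted_coeff D z : plane R :=
  (D * (O.1 - (center w).1) - W * (z.1 - (center w).1),
   D * (O.2 - (center w).2) - W * (z.2 - (center w).2)).

(** The equation of the inverse of a circle with centre [z] for which the
    centre of inversion has power [D].  The coefficient vector
    [inverted_coeff] is that of the same equation in coordinates with origin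
    [O]. *)
Definition inverted_power D z q : R :=
  gpower (center w) D
    (- W * (z.1 - (center w).1), - W * (z.2 - (center w).2)) (radius w ^+ 4) q.

Lemma on_circle_inversion c p : p <> center w -> on_circle c p ->
  inverted_power (sqdist (center c) (center w) - radius c ^+ 2) (center c) (J p)
  = 0.
Proof.
move=> npw cp; have := power_inversion (center c) (radius c ^+ 2) npw.
by rewrite cp subrr mulr0 => /esym.
Qed.

Lemma inverted_powerE D z q : inverted_power D z q =
  gpower O D (inverted_coeff D z) (inverted_power D z O) q.
Proof.
rewrite /inverted_power (gpower_rebase O) /inverted_coeff.
by rewrite /gpower /dot /vec /sqdist /=; ring.
Qed.

(** A circle through two distinct mirror points is symmetric in the axis,
    which then contains its centre. *)
Lemma reflected_zero D z nrm d q : dot nrm nrm = 1 -> dot nrm q != d ->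
  inverted_power D z q = 0 -> inverted_power D z (refl nrm d q) = 0 ->
  D * (d - dot nrm (center w)) = W * dot nrm (vec (center w) z).
Proof.
move=> n1 nq f1 f2; rewrite -subr_eq0 in nq.
apply: (mulfI nq).
apply: (eq_comb (eqD (eqM (- 4^-1) f2) (eqD (eqM 4^-1 f1)
  (eqM (D * (dot nrm q - d) ^+ 2) n1)))).
by rewrite /inverted_power /gpower /refl /dot /vec /sqdist /=; field.
Qed.

(** The result of eliminating [D] from the relations [reflected_zero] and
    [chord_zero]. *)
Definition chord_conic nrm d S T z : R :=
  let v := vec (center w) z in let o := vec (center w) O in
  let d' := d - dot nrm (center w) in
  (dot nrm v * (S + dot o o) - 2 * d' * dot v o + d' * W) ^+ 2 -
  (4 * S - T) * ((dot nrm v * o.1 - d' * v.1) ^+ 2 +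
                 (dot nrm v * o.2 - d' * v.2) ^+ 2).

(** The vector [h] is orthogonal to the chord [q1 q2], hence parallel to the
    sum of the vectors to its ends; [4 S - T] is the squared norm of this sum.
    *)
Lemma isosceles_norm h q1 q2 S T :
    sqdist q1 O = S -> sqdist q2 O = S -> sqdist q1 q2 = T -> T != 0 ->
    dot h (vec O q1) = dot h (vec O q2) ->
  (- (dot h (vec O q1) + dot h (vec O q2))) ^+ 2 = (4 * S - T) * dot h h.
Proof.
move=> h1 h2 h12 T0; set a := vec O q1; set b := vec O q2 => hab.
pose m : plane R := (a.1 + b.1, a.2 + b.2).
pose g : plane R := (a.1 - b.1, a.2 - b.2).
have s2 : dot m m = 4 * S - T.
  apply: (eq_comb (eqD (eqM 2 h1) (eqD (eqM 2 h2) (eqM (-1) h12)))).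
  by rewrite /m /a /b /dot /vec /sqdist /=; ring.
have gg : dot g g != 0.
  rewrite (_ : dot g g = T) // -h12.
  by rewrite /g /a /b /dot /vec /sqdist /=; ring.
have hg : dot h g = 0.
  by apply: (eq_comb hab); rewrite /g /dot /=; ring.
have sg : dot m g = 0.
  apply: (eq_comb (eqD h1 (eqM (-1) h2))).
  by rewrite /m /g /a /b /dot /vec /sqdist /=; ring.
have cr : cross h m = 0.
  apply: (mulIf gg); rewrite mul0r.
  apply: (eq_comb (eqD (eqM (cross g m) hg) (eqM (- cross g h) sg))).
  by rewrite /cross /dot /=; ring.
rewrite -s2; apply: (eq_comb (eqM (- cross h m) cr)).
by rewrite /cross /dot /m /=; ring.
Qed.

Lemma chord_zero D z S T q1 q2 : sqdist q1 O = S -> sqdist q2 O = S ->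
    sqdist q1 q2 = T -> T != 0 ->
    inverted_power D z q1 = 0 -> inverted_power D z q2 = 0 ->
  let h := inverted_coeff D z in
  (D * S + inverted_power D z O) ^+ 2 = (4 * S - T) * dot h h.
Proof.
move=> h1 h2 h12 T0.
rewrite (inverted_powerE D z q1) (inverted_powerE D z q2) /=.
move: (inverted_coeff D z) (inverted_power D z O) => h E f1 f2.
have hab : dot h (vec O q1) = dot h (vec O q2).
  apply: (eq_comb (eqD (eqM 2^-1 f1) (eqD (eqM (- 2^-1) f2)
    (eqD (eqM (- D / 2) h1) (eqM (D / 2) h2))))).
  by rewrite /gpower /dot /vec /sqdist /=; field.
rewrite -(isosceles_norm h1 h2 h12 T0 hab); congr (_ ^+ 2).
apply: (eq_comb (eqD (eqM 2^-1 f1) (eqD (eqM 2^-1 f2)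
  (eqD (eqM (- D / 2) h1) (eqM (- D / 2) h2))))).
by rewrite /gpower /dot /vec /sqdist /=; field.
Qed.

Lemma chord_conicE D z nrm d S T : 
    D * (d - dot nrm (center w)) = W * dot nrm (vec (center w) z) ->
    (D * S + inverted_power D z O) ^+ 2 =
      (4 * S - T) * dot (inverted_coeff D z) (inverted_coeff D z) ->
  chord_conic nrm d S T z = 0.
Proof.
move=> h1 h2; apply: (mulfI W0); apply: (mulfI W0); rewrite !mulr0.
have WW : W * W * chord_conic nrm d S T z =
  (d - dot nrm (center w)) ^+ 2 * ((D * S + inverted_power D z O) ^+ 2 -
    (4 * S - T) * dot (inverted_coeff D z) (inverted_coeff D z)).
  rewrite /chord_conic.
  set y := dot nrm (vec _ z) in h1 *; set d' := d - _ in h1 *.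
  set o := vec _ O; set v := vec _ z.
  transitivity ((D * d' * (S + dot o o) + d' * (W ^+ 2 - 2 * W * dot v o)) ^+ 2
    - (4 * S - T) * ((D * d' * o.1 - d' * W * v.1) ^+ 2 +
                     (D * d' * o.2 - d' * W * v.2) ^+ 2)).
    by rewrite h1; ring.
  rewrite /inverted_power /gpower /inverted_coeff /o /v /sqdist /dot /vec /=.
  ring.
by rewrite mulrA WW h2 subrr mulr0.
Qed.

Lemma chord_conic_quadratic nrm d S T : quadratic_fun (chord_conic nrm d S T).
Proof.
rewrite /chord_conic /=.
set o := vec _ O; set d' := d - _.
have q1 := @quadratic_sqr (fun z => dot nrm (vec (center w) z) * (S + dot o o) -
   2 * d' * dot (vec (center w) z) o + d' * W) ltac:(by apply: affine_funI => p;
   rewrite /dot /vec /=; ring).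
have q2 := @quadratic_sqr (fun z =>
     dot nrm (vec (center w) z) * o.1 - d' * (z.1 - (center w).1))
   ltac:(by apply: affine_funI => p; rewrite /dot /vec /=; ring).
have q3 := @quadratic_sqr (fun z =>
     dot nrm (vec (center w) z) * o.2 - d' * (z.2 - (center w).2))
   ltac:(by apply: affine_funI => p; rewrite /dot /vec /=; ring).
have q := quadratic_lin (- (4 * S - T)) q1 (quadratic_lin 1 q2 q3).
have [a [b [c [e [g [m h]]]]]] := q.
by exists a, b, c, e, g, m => p; rewrite -h /=; ring.
Qed.

Definition circle_avoiding_center c p1 p2 p3 p4 :=
  passes_through c p1 p2 p3 p4 /\
  [/\ p1 <> center w, p2 <> center w, p3 <> center w & p4 <> center w].

(** If both [J p1] and [J p2] lie on the axis, the four points are only two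
    and do not make the circle symmetric; the last clause excludes this. *)
Definition symmetric_after_inversion nrm d c p1 p2 p1' p2' :=
  [/\ circle_avoiding_center c p1 p2 p1' p2',
      J p1' = refl nrm d (J p1), J p2' = refl nrm d (J p2) &
      ~ (dot nrm (J p1) = d /\ dot nrm (J p2) = d)].

Lemma symmetric_axis nrm d c p1 p2 p1' p2' : dot nrm nrm = 1 ->
    symmetric_after_inversion nrm d c p1 p2 p1' p2' ->
  (sqdist (center c) (center w) - radius c ^+ 2) * (d - dot nrm (center w)) =
  W * dot nrm (vec (center w) (center c)).
Proof.
move=> n1 [[[c1 c2 c3 c4] [m1 m2 m3 m4]] e1 e2 nfix].
have f1 := on_circle_inversion m1 c1; have f2 := on_circle_inversion m2 c2.
have := on_circle_inversion m4 c4; have := on_circle_inversion m3 c3.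
rewrite e1 e2 => f3 f4.
case: (eqVneq (dot nrm (J p1)) d) => [h1|h1]; last exact: reflected_zero f3.
case: (eqVneq (dot nrm (J p2)) d) => [h2|h2]; last exact: reflected_zero f4.
by case: nfix.
Qed.

(** If the axis passes through the centre of inversion, the original circles
    are symmetric in it as well. *)
Lemma axis_through_center_conic nrm d : dot nrm nrm = 1 ->
    d - dot nrm (center w) = 0 ->
  exists H, conic H /\ forall c p1 p2 p1' p2',
    symmetric_after_inversion nrm d c p1 p2 p1' p2' -> H (center c).
Proof.
move=> n1 d0; pose f z := dot nrm (vec (center w) z).
have qf : quadratic_fun f.
  apply: affine_quadratic; apply: affine_funI => p.
  by rewrite /f /dot /vec /=; ring.
have fz : f ((center w).1 + nrm.1, (center w).2 + nrm.2) != 0.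
  have <- : 1 = f ((center w).1 + nrm.1, (center w).2 + nrm.2).
    by rewrite -n1 /f /dot /vec /=; ring.
  exact: oner_neq0.
have [H [cH hH]] := conic_cover qf fz; exists H; split=> //.
move=> c p1 p2 p1' p2' /(symmetric_axis n1); rewrite d0 mulr0 => e.
by apply: hH; apply: (mulfI W0); rewrite mulr0 /f -e.
Qed.

(** The polynomial [chord_conic] does not vanish at the centre of inversion
    unless the axis passes through it. *)
Lemma reflected_chord_conic nrm d S T : dot nrm nrm = 1 -> T != 0 ->
  exists H, conic H /\ forall c p1 p2 p1' p2',
    symmetric_after_inversion nrm d c p1 p2 p1' p2' ->
    sqdist (J p1) O = S -> sqdist (J p2) O = S -> sqdist (J p1) (J p2) = T ->
    H (center c).
Proof.
move=> n1 T0; case: (eqVneq (d - dot nrm (center w)) 0) => [d0|d0].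
  have [H [cH hH]] := axis_through_center_conic n1 d0.
  by exists H; split=> // c p1 p2 p1' p2' /hH.
have fz : chord_conic nrm d S T (center w) != 0.
  rewrite (_ : chord_conic _ _ _ _ _ = ((d - dot nrm (center w)) * W) ^+ 2).
    by rewrite sqrf_eq0 mulf_neq0.
  by rewrite /chord_conic /dot /vec /=; ring.
have [H [cH hH]] := conic_cover (chord_conic_quadratic nrm d S T) fz.
exists H; split=> // c p1 p2 p1' p2' sym s1 s2 s12.
apply: hH; apply: chord_conicE (symmetric_axis n1 sym) _.
case: sym => -[[c1 c2 _ _] [m1 m2 _ _]] _ _ _.
by apply: (chord_zero s1 s2 s12 T0); apply: on_circle_inversion.
Qed.

(** The values [t] and [s] are the zeros of a quadratic polynomial on the line
    [O C]; the two relations are those between its zeros and coefficients. *)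
Lemma ray_zero D z S C t s : t != s -> sqdist C O = S ->
    inverted_power D z (along O C t) = 0 ->
    inverted_power D z (along O C s) = 0 ->
  inverted_power D z O = D * (t * s * S) /\
  D * (t + s) * S + 2 * dot (inverted_coeff D z) (vec O C) = 0.
Proof.
rewrite -subr_eq0 => ts hC.
rewrite (inverted_powerE D z (along O C t)) (inverted_powerE D z (along O C s)).
move: (inverted_power D z O) (inverted_coeff D z) => E h f1 f2.
split; apply: (mulfI ts).
  apply: (eq_comb (eqD (eqM (- s) f1) (eqD (eqM t f2)
    (eqM (D * (t * s) * (t - s)) hC)))).
  by rewrite /gpower /along /dot /vec /sqdist /=; ring.
apply: (eq_comb (eqD f1 (eqD (eqM (-1) f2)
  (eqM (- D * (t ^+ 2 - s ^+ 2)) hC)))).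
by rewrite /gpower /along /dot /vec /sqdist /=; ring.
Qed.

(** The power of [O] with respect to the inverted circle is [t s S], up to the
    factor [D].  Together with the relation given by the axis, this is a
    linear equation for the centre. *)
Lemma reflected_ray_conic nrm d S t s : dot nrm nrm = 1 -> t != s ->
  exists H, conic H /\ forall c p1 p2 p1' p2' C,
    symmetric_after_inversion nrm d c p1 p2 p1' p2' ->
    J p1 = along O C t -> J p2 = along O C s -> sqdist C O = S ->
    H (center c).
Proof.
move=> n1 ts; case: (eqVneq (d - dot nrm (center w)) 0) => [d0|d0].
  have [H [cH hH]] := axis_through_center_conic n1 d0.
  by exists H; split=> // c p1 p2 p1' p2' C /hH.
pose o := vec (center w) O; pose d' := d - dot nrm (center w).
pose f z := dot nrm (vec (center w) z) * (dot o o - t * s * S) -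
  2 * d' * dot (vec (center w) z) o + d' * W.
have qf : quadratic_fun f.
  by apply: affine_quadratic; apply: affine_funI => p;
    rewrite /f /dot /vec /=; ring.
have fz : f (center w) != 0.
  have -> : f (center w) = d' * W by rewrite /f /dot /vec /=; ring.
  by rewrite mulf_neq0.
have [H [cH hH]] := conic_cover qf fz; exists H; split=> //.
move=> c p1 p2 p1' p2' C sym e1 e2 hC; apply: hH; apply: (mulfI W0).
have := symmetric_axis n1 sym; rewrite -/d'.
case: sym => -[[c1 c2 _ _] [m1 m2 _ _]] _ _ _.
have f1 := on_circle_inversion m1 c1; have f2 := on_circle_inversion m2 c2.
move: (_ - radius c ^+ 2) f1 f2 => D f1 f2 ax.
rewrite e1 in f1; rewrite e2 in f2.
have [eO _] := ray_zero ts hC f1 f2.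
apply: (eq_comb (eqD (eqM d' eO) (eqM (t * s * S - dot o o) ax))).
rewrite /f /o /inverted_power /gpower /sqdist /dot /vec /=; ring.
Qed.

(** By [ray_zero] the power of [O] is constant, and the component of the
    coefficient vector along [O C1] and [O C2] is proportional to [D].
    Eliminating [D] gives a quadratic equation if [kappa <> 0]; otherwise the
    first relation is already a linear equation for the centre. *)
Lemma swapped_chord_conic S T t s : 0 < S -> T != 0 -> t != s -> t + s != 0 ->
  exists H, conic H /\ forall c p1 p2 q1 q2 C1 C2,
    circle_avoiding_center c p1 p2 q1 q2 ->
    J p1 = along O C1 t -> J p2 = along O C2 t ->
    J q1 = along O C1 s -> J q2 = along O C2 s ->
    sqdist C1 O = S -> sqdist C2 O = S -> sqdist C1 C2 = T ->
    H (center c).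
Proof.
move=> S0 T0 ts ts0; pose o := vec (center w) O.
pose kappa := t * s * S - dot o o.
have rel c p1 p2 q1 q2 C1 C2 : circle_avoiding_center c p1 p2 q1 q2 ->
    J p1 = along O C1 t -> J p2 = along O C2 t ->
    J q1 = along O C1 s -> J q2 = along O C2 s ->
    sqdist C1 O = S -> sqdist C2 O = S -> sqdist C1 C2 = T ->
    exists D,
     D * kappa = W * (W - 2 * dot (vec (center w) (center c)) o) /\
     ((t + s) * S * D) ^+ 2 = (4 * S - T) *
       dot (inverted_coeff D (center c)) (inverted_coeff D (center c)).
  move=> [[c1 c2 c3 c4] [m1 m2 m3 m4]] e1 e2 e3 e4 h1 h2 h12.
  exists (sqdist (center c) (center w) - radius c ^+ 2).
  have := on_circle_inversion m1 c1; have := on_circle_inversion m2 c2.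
  have := on_circle_inversion m3 c3; have := on_circle_inversion m4 c4.
  rewrite e1 e2 e3 e4; move: (_ - radius c ^+ 2) => D f4 f3 f2 f1.
  have [eO r1] := ray_zero ts h1 f1 f3; have [_ r2] := ray_zero ts h2 f2 f4.
  split.
    apply: (eq_comb (eqM (-1) eO)).
    by rewrite /kappa /o /inverted_power /gpower /sqdist /dot /vec /=; ring.
  move: (inverted_coeff D (center c)) r1 r2 => h r1 r2.
  pose a := vec O C1; pose b := vec O C2.
  have hab : dot h a = dot h b.
    by apply: (eq_comb (eqM 2^-1 (eqD r1 (eqM (-1) r2)))); rewrite /a /b; field.
  have e : (t + s) * S * D = - (dot h a + dot h b).
    by apply: (eq_comb (eqM 2^-1 (eqD r1 r2))); rewrite /a /b; field.
  rewrite e; exact: (isosceles_norm h1 h2 h12 T0 hab).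
case: (eqVneq kappa 0) => [k0|k0].
  pose f z := W - 2 * dot (vec (center w) z) o.
  have qf : quadratic_fun f.
    by apply: affine_quadratic; apply: affine_funI => p;
      rewrite /f /dot /vec /=; ring.
  have fz : f (center w) != 0.
    have -> : f (center w) = W by rewrite /f /dot /vec /=; ring.
    exact: W0.
  have [H [cH hH]] := conic_cover qf fz; exists H; split=> //.
  move=> c p1 p2 q1 q2 C1 C2 cyc e1 e2 e3 e4 h1 h2 h12.
  have [D [r _]] := rel _ _ _ _ _ _ _ cyc e1 e2 e3 e4 h1 h2 h12.
  by apply/hH/(mulfI W0); rewrite mulr0 /f -r k0 mulr0.
pose g z := W - 2 * dot (vec (center w) z) o.
pose f z := ((t + s) * S * g z) ^+ 2 - (4 * S - T) *
  ((g z * o.1 - kappa * (z.1 - (center w).1)) ^+ 2 +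
   (g z * o.2 - kappa * (z.2 - (center w).2)) ^+ 2).
have qf : quadratic_fun f.
  have q1 := @quadratic_sqr (fun z => (t + s) * S * g z) ltac:(by
    apply: affine_funI => p; rewrite /g /dot /vec /=; ring).
  have q2 := @quadratic_sqr (fun z => g z * o.1 - kappa * (z.1 - (center w).1))
    ltac:(by apply: affine_funI => p; rewrite /g /dot /vec /=; ring).
  have q3 := @quadratic_sqr (fun z => g z * o.2 - kappa * (z.2 - (center w).2))
    ltac:(by apply: affine_funI => p; rewrite /g /dot /vec /=; ring).
  have [a [b [c [d [e [m h]]]]]] :=
    quadratic_lin (- (4 * S - T)) q1 (quadratic_lin 1 q2 q3).
  by exists a, b, c, d, e, m => p; rewrite -h /f; ring.
have [z fz] : exists z, f z != 0.
  case: (eqVneq (f (center w)) 0) => [f0|]; last by exists (center w).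
  (* At a point displaced orthogonally to [o] the function [g] has the same
     value as at the centre of inversion, so only the terms with [kappa]
     change. *)
  pose x : plane R := ((center w).1 - o.2, (center w).2 + o.1).
  exists x; have -> : f x = f (center w) - (4 * S - T) * dot o o * kappa ^+ 2.
    by rewrite /f /g /x /dot /vec /=; ring.
  rewrite f0 sub0r oppr_eq0 mulf_neq0 ?sqrf_eq0 //.
  have : W ^+ 2 * ((4 * S - T) * dot o o) = W ^+ 2 * ((t + s) * S) ^+ 2.
    by apply: (eq_comb (eqM (-1) f0)); rewrite /f /g /dot /vec /=; ring.
  move/(mulfI (expf_neq0 2 W0)) ->.
  by rewrite sqrf_eq0 mulf_neq0 // lt0r_neq0.
have [H [cH hH]] := conic_cover qf fz; exists H; split=> //.
move=> c p1 p2 q1 q2 C1 C2 cyc e1 e2 e3 e4 h1 h2 h12.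
have [D [r1 r2]] := rel _ _ _ _ _ _ _ cyc e1 e2 e3 e4 h1 h2 h12.
apply/hH/(mulfI W0)/(mulfI W0); rewrite !mulr0.
transitivity (((t + s) * S * (D * kappa)) ^+ 2 - (4 * S - T) *
  ((D * kappa * o.1 - kappa * W * ((center c).1 - (center w).1)) ^+ 2 +
   (D * kappa * o.2 - kappa * W * ((center c).2 - (center w).2)) ^+ 2)).
  by rewrite r1 /f /g; ring.
apply: (eq_comb (eqM (kappa ^+ 2) r2)).
by rewrite /inverted_coeff /o /dot /vec /=; ring.
Qed.

End InvertedCircles.
End Conics.

(** * Mirror images that exchange the two tangent circles *)

Section SwappedReflection.
Variable R : realType.
Implicit Types (p q O C X h nrm : plane R) (A E S T t s d : R).

(** Subtracting the equations at [Ci] and [Cj] shows that both the coefficient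
    vector [h] and its mirror image [h - 2 y nrm] are orthogonal to [Ci - Cj].
    If they differ, so is [nrm].  If they agree, [- h / A] is the centre of
    the circle seen from [O]; it lies on the axis, and it is the pole of the
    line [Ci Cj] with respect to the ring, because [t + s = 2]. *)
Lemma swapped_reflection_step O Ci Cj nrm d S t s A h E :
    sqdist Ci O = S -> sqdist Cj O = S ->
    cross (vec O Ci) (vec O Cj) != 0 -> dot nrm nrm = 1 ->
    t + s = 2 -> t != s -> t != 0 -> s != 0 ->
    ~ [/\ A = 0, h = (0, 0) & E = 0] ->
    gpower O A h E (along O Ci t) = 0 -> gpower O A h E (along O Cj t) = 0 ->
    gpower O A h E (refl nrm d (along O Ci s)) = 0 ->
    gpower O A h E (refl nrm d (along O Cj s)) = 0 ->
  dot nrm Ci = dot nrm Cj \/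
  exists X, [/\ dot X nrm = d - dot nrm O, dot X (vec O Ci) = S &
                dot X (vec O Cj) = S].
Proof.
move=> hi hj cij n1 ts2 ts t0 s0 nz fi fj gi gj.
pose d' := d - dot nrm O; pose y := A * d' + dot h nrm.
have zero1 C : sqdist C O = S -> gpower O A h E (along O C t) = 0 ->
    A * t ^+ 2 * S + 2 * t * dot h (vec O C) + E = 0.
  move=> hC f; apply: (eq_comb (eqD f (eqM (- A * t ^+ 2) hC))).
  by rewrite /gpower /along /dot /vec /sqdist /=; ring.
have zero2 C : sqdist C O = S ->
    gpower O A h E (refl nrm d (along O C s)) = 0 ->
    A * s ^+ 2 * S + 2 * s * (dot h (vec O C) - 2 * y * dot nrm (vec O C))
      + E + 4 * d' * y = 0.
  move=> hC f; apply: (eq_comb (eqD f (eqD (eqM (- A * s ^+ 2) hC)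
    (eqM (- 4 * A * (dot nrm (along O C s) - d) ^+ 2) n1)))).
  by rewrite /y /d' /gpower /along /refl /dot /vec /sqdist /=; ring.
have zi := zero1 _ hi fi; have zj := zero1 _ hj fj.
have wi := zero2 _ hi gi; have wj := zero2 _ hj gj.
have hij : dot h (vec O Ci) = dot h (vec O Cj).
  apply: (mulfI t0); apply: (eq_comb (eqM 2^-1 (eqD zi (eqM (-1) zj)))).
  by field.
have yij : y * (dot nrm Ci - dot nrm Cj) = 0.
  apply: (mulfI s0).
  apply: (eq_comb (eqD (eqM (s / 2) hij)
    (eqM (- 4^-1) (eqD wi (eqM (-1) wj))))).
  have -> : y * (dot nrm Ci - dot nrm Cj) =
      y * (dot nrm (vec O Ci) - dot nrm (vec O Cj)).
    by rewrite /dot /vec /=; ring.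
  by field.
case: (eqVneq y 0) => [y0|y0]; last first.
  left; apply/subr0_eq; apply: (mulfI y0); by rewrite yij mulr0.
right.
rewrite -subr_eq0 in ts.
have half C : A * t ^+ 2 * S + 2 * t * dot h (vec O C) + E = 0 ->
    A * s ^+ 2 * S + 2 * s * (dot h (vec O C) - 2 * y * dot nrm (vec O C))
      + E + 4 * d' * y = 0 -> dot h (vec O C) = - A * S.
  rewrite y0 => e1 e2; apply: (mulfI ts).
  apply: (eq_comb (eqD (eqM 2^-1 (eqD e1 (eqM (-1) e2)))
     (eqM (- A * S * (t - s) / 2) ts2))).
  by field.
have ui := half _ zi wi; have uj := half _ zj wj.
have A0 : A != 0.
  apply/eqP => A0; apply: nz; rewrite A0 in ui uj zi.
  have h1 : h.1 = 0.
    apply: (mulfI cij); rewrite mulr0.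
    apply: (eq_comb (eqD (eqM ((vec O Cj).2) ui) (eqM (- (vec O Ci).2) uj))).
    by rewrite /dot /cross; ring.
  have h2 : h.2 = 0.
    apply: (mulfI cij); rewrite mulr0.
    apply: (eq_comb (eqD (eqM (- (vec O Cj).1) ui) (eqM ((vec O Ci).1) uj))).
    by rewrite /dot /cross; ring.
  split=> //; first exact: plane_eq.
  by move: zi; rewrite /dot h1 h2; lra.
exists (- h.1 / A, - h.2 / A); split; apply: (mulfI A0).
- rewrite -/d'; apply: (eq_comb (eqM (-1) y0)).
  by rewrite /y /dot /=; field.
- by apply: (eq_comb (eqM (-1) ui)); rewrite /dot /=; field.
- by apply: (eq_comb (eqM (-1) uj)); rewrite /dot /=; field.
Qed.

Lemma ring_chain_cross n O S T (C : 'Z_n -> plane R) i : (2 < n)%N ->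
  ring_chain O S T C -> cross (vec O (C i)) (vec O (C (i + 1))) != 0.
Proof.
move=> n2 ch; have [a [b [b0 h]]] := ring_chain_rotation n2 ch.
have S0 := ring_chain_gt0 ch; have hS : sqdist (C i) O = S by case: ch.
rewrite (_ : cross _ _ = b * S); first by rewrite mulf_neq0 // lt0r_neq0.
by rewrite h -hS /cross /vec /rotate /sqdist /=; ring.
Qed.

(** Consider [swapped_reflection_step] for the neighbours of [C 1], which lies
    on the axis.  A point [X] on the axis whose polar line passes through [C
    1] is [C 1] itself unless the axis touches the ring at [C 1], and the
    polar line of [C 1] contains no other point of the ring.  So either the
    three points [C 0], [C 1], [C 2] of the ring lie on the axis, which is
    absurd, or the axis touches the ring at [C 1].  In the latter case [C 0]
    and [C 2] are equidistant from the axis, and the step from [C 2] to [C 3]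
    puts three points of the ring on a line: a parallel to the axis, or the
    polar line of [X]. *)
Lemma swapped_reflection_absurd n O S T (C : 'Z_n -> plane R) nrm d t s :
    (3 < n)%N -> ring_chain O S T C -> dot nrm nrm = 1 ->
    dot nrm (C 1) = d -> t + s = 2 -> t != s -> t != 0 -> s != 0 ->
    (forall i j, i <> j -> exists A h E, ~ [/\ A = 0, h = (0, 0) & E = 0] /\
      [/\ gpower O A h E (along O (C i) t) = 0,
          gpower O A h E (along O (C j) t) = 0,
          gpower O A h E (refl nrm d (along O (C i) s)) = 0 &
          gpower O A h E (refl nrm d (along O (C j) s)) = 0]) ->
  False.
Proof.
move=> n3 ch n1 nK ts2 ts t0 s0 cyc; have n2 : (2 < n)%N by apply: ltnW.
have S0 := ring_chain_gt0 ch; have [hS hT inj] := ch.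
have step i : dot nrm (C i) = dot nrm (C (i + 1)) \/
  exists X, [/\ dot X nrm = d - dot nrm O, dot X (vec O (C i)) = S &
                dot X (vec O (C (i + 1))) = S].
  have ni : i <> i + 1.
    by move/eqP; rewrite -{1}[i]addr0 (inj_eq (addrI i)) eq_sym oner_eq0.
  have [A [h [E [nz [f1 f2 f3 f4]]]]] := cyc _ _ ni.
  exact: (swapped_reflection_step (hS i) (hS (i + 1)) (ring_chain_cross i n2 ch)
    n1 ts2 ts t0 s0 nz f1 f2 f3 f4).
pose u i := vec O (C i).
have uu i : dot (u i) (u i) = S.
  by rewrite -(hS i) /u /dot /vec /sqdist /=; ring.
have nu : dot nrm (u 1) = d - dot nrm O by rewrite -nK /u /dot /vec /=; ring.
have apex X j : C j <> C 1 -> dot X nrm = d - dot nrm O ->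
    dot X (u 1) = S -> dot X (u j) = S -> cross nrm (u 1) = 0.
  move=> nj Xn X1 Xj; case: (eqVneq (cross nrm (u 1)) 0) => // cr0.
  case: nj; have E1 : X = u 1.
    have e1 : dot X nrm = dot (u 1) nrm.
      by rewrite Xn -nu /dot; ring.
    have e2 : dot X (u 1) = dot (u 1) (u 1) by rewrite X1 uu.
    apply: plane_eq; apply: (mulfI cr0).
      apply: (eq_comb (eqD (eqM (u 1).2 e1) (eqM (- nrm.2) e2))).
      by rewrite /cross /dot; ring.
    apply: (eq_comb (eqD (eqM (- (u 1).1) e1) (eqM nrm.1 e2))).
    by rewrite /cross /dot; ring.
  rewrite E1 in Xj; apply: sqdist_eq0.
  apply: (eq_comb (eqD (uu j) (eqD (uu 1) (eqM (-2) Xj)))).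
  by rewrite /u /dot /vec /sqdist /=; ring.
have Zneq (j k : nat) : (j < k < 4)%N -> C j%:R <> C k%:R.
  case/andP=> jk k4 /inj/eqP; rewrite eq_sym -subr_eq0 -natrB 1?ltnW //.
  apply/negP/natr_Zn_neq0; rewrite subn_gt0 jk /=.
  by apply: leq_ltn_trans (leq_subr _ _) _; apply: leq_trans k4 _.
have e01 : 0 + 1 = 1 :> 'Z_n by rewrite add0r.
have e2 : 1 + 1 = 2%:R :> 'Z_n by rewrite -(natrD _ 1 1).
have e3 : 2%:R + 1 = 3%:R :> 'Z_n by rewrite natr1.
have nrm0 : nrm <> (0, 0).
  by move=> e; move/eqP: n1; rewrite e /dot /= mulr0 addr0 eq_sym oner_eq0.
have par : cross nrm (u 1) = 0.
  case: (step 0) => [h0|[X [Xn X0 X1]]]; last first.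
    by rewrite e01 in X1; apply: (apex X 0) => //; apply: (Zneq 0 1).
  case: (step 1) => [h1|[X [Xn X1 X2]]]; last first.
    by apply: (apex X (1 + 1)) => //; rewrite e2 => /esym; apply: (Zneq 1 2).
  rewrite e01 in h0; rewrite e2 in h1; case: nrm0.
  apply: (three_on_circle (hS 0) (hS 1) (hS 2%:R)) => //.
  - exact: (Zneq 0 1).
  - exact: (Zneq 0 2).
  - exact: (Zneq 1 2).
  - by rewrite h0.
set d' := d - dot nrm O in nu step apex.
have u1E : u 1 = (d' * nrm.1, d' * nrm.2).
  apply: plane_eq => /=.
    by apply: (eq_comb (eqD (eqM (- nrm.2) par)
      (eqD (eqM nrm.1 nu) (eqM (- (u 1).1) n1))));
      rewrite /cross /dot /u /vec /=; ring.
  by apply: (eq_comb (eqD (eqM nrm.1 par)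
    (eqD (eqM nrm.2 nu) (eqM (- (u 1).2) n1))));
    rewrite /cross /dot /u /vec /=; ring.
have dS : d' * d' = S.
  rewrite -(uu 1) u1E; apply: (eq_comb (eqM (- (d' * d')) n1)).
  by rewrite /dot /=; ring.
have d0 : d' != 0 by apply/eqP => e; move: S0; rewrite -dS e mulr0 ltxx.
have dX X : dot X (u 1) = d' * dot X nrm by rewrite u1E /dot /=; ring.
have n02 : dot nrm (C 0) = dot nrm (C 2%:R).
  apply: (mulfI d0).
  have h0 := hT 0; have h2 := hT 1; rewrite e01 in h0; rewrite e2 in h2.
  have E0 := dX (u 0); have E2 := dX (u 2%:R).
  apply: (eq_comb (eqD (eqM (-1) E0) (eqD E2 (eqM 2^-1 (eqD (uu 0)
    (eqD (eqM (-1) (uu 2%:R)) (eqD (eqM (-1) h0) h2))))))).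
  by rewrite /u /dot /vec /sqdist /=; field.
have := step (1 + 1); rewrite e2 e3 => -[h|[X [Xn X2 X3]]].
  case: nrm0; apply: (three_on_circle (hS 0) (hS 2%:R) (hS 3%:R)) => //.
  - exact: (Zneq 0 2).
  - exact: (Zneq 0 3).
  - exact: (Zneq 2 3).
  - by rewrite n02.
have X1 : dot X (u 1) = S by rewrite dX Xn dS.
have X0 : X = (0, 0).
  apply: (three_on_circle (hS 1) (hS 2%:R) (hS 3%:R)).
  - exact: (Zneq 1 2).
  - exact: (Zneq 1 3).
  - exact: (Zneq 2 3).
  - by apply: (eq_comb (eqD X1 (eqM (-1) X2))); rewrite /u /dot /vec /=; ring.
  - by apply: (eq_comb (eqD X1 (eqM (-1) X3))); rewrite /u /dot /vec /=; ring.
by move: S0; rewrite -X1 X0 /dot /= !mul0r addr0 ltxx.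
Qed.

End SwappedReflection.

(** * The four families of circles *)

Section Assembly.
Variable R : realType.
Implicit Types (c w : circle R) (p q O h nrm : plane R) (S T a b e d : R).

Lemma inverted_steiner_chain n w (l m : circle R) (k : 'Z_n -> circle R) :
    sends_to_concentric w l m -> steiner_chain l m k ->
  exists (k' : 'Z_n -> circle R) O S T e,
    [/\ forall i, inverts w (k i) (k' i),
        ring_chain O S T (fun i => center (k' i)),
        [/\ e != 0, e ^+ 2 < 1 & 4 * (e ^+ 2 * S) = T],
        forall i, 4 * radius (k' i) ^+ 2 = T &
        forall i p,
          [/\ tangent_at (k i) l p -> p <> center w /\
                inversion w p = along O (center (k' i)) (1 + e),
              tangent_at (k i) m p -> p <> center w /\
                inversion w p = along O (center (k' i)) (1 - e) &
              tangent_at (k i) (k (i + 1)) p -> p <> center w /\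
                inversion w p =
                  along (center (k' i)) (center (k' (i + 1))) 2^-1]].
Proof.
move=> [l' [m' [/inverts_image il /inverts_image im ec]]] ch.
have [k' [ik ch']] := steiner_chain_inverts il im ec ch.
have [S [T [rc [e0 e1 eS] rad [tl tm] tn]]] :=
  concentric_steiner_chain ec ch'.
exists k', (center l'), S, T; eexists.
split; [exact: ik|exact: rc|split; [exact: e0|exact: e1|exact: eS]|exact: rad|].
move=> i p; have nw c : tangent_at (k i) c p -> p <> center w.
  by case/tangent_atP=> kp _ _ e; apply: (inverts_center (ik i)); rewrite -e.
split=> tg; split; try exact: nw tg.
- exact: tl (tangent_inverts (ik i) il tg).
- exact: tm (tangent_inverts (ik i) im tg).
- exact: tn (tangent_inverts (ik i) (ik (i + 1)) tg).
Qed.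

Lemma the_circle_throughC c p q r s :
  the_circle_through c p q r s -> the_circle_through c p q s r.
Proof.
move=> [[cp cq cr cs] uniq]; split=> // c' [c'p c'q c's c'r].
exact: uniq.
Qed.

Lemma two_points_not_determined c p q : ~ the_circle_through c p q p q.
Proof.
move=> [[cp cq _ _] uniq]; have [c' [c'p c'q]] := other_circle_through cp cq.
by apply; apply: uniq.
Qed.

Definition same_or_mirror n O1 (C1 : 'Z_n -> plane R) O2 C2 :=
  (O1 = O2 /\ C1 =1 C2) \/
  exists nrm d, [/\ dot nrm nrm = 1, dot nrm (C1 1) = d, O2 = refl nrm d O1 &
                    forall i, C2 i = refl nrm d (C1 i)].

Lemma refl_fixed nrm d q : dot nrm q = d -> refl nrm d q = q.
Proof. by move=> e; rewrite /refl e; apply: plane_eq => /=; ring. Qed.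

Lemma symmetric_after_inversionI w nrm d c p1 p2 p1' p2' :
    p1 <> center w -> p2 <> center w -> p1' <> center w -> p2' <> center w ->
    inversion w p1' = refl nrm d (inversion w p1) ->
    inversion w p2' = refl nrm d (inversion w p2) ->
    the_circle_through c p1 p2 p1' p2' ->
  symmetric_after_inversion w nrm d c p1 p2 p1' p2'.
Proof.
move=> n1 n2 n3 n4 e1 e2 the_c; split=> //; first by case: the_c.
move=> [f1 f2]; move: the_c.
rewrite (inversion_inj (etrans e1 (refl_fixed f1))).
rewrite (inversion_inj (etrans e2 (refl_fixed f2))).
exact: two_points_not_determined.
Qed.

Lemma no_circle_conic (I : Type) (P : I -> circle R -> Prop) :
  (forall i c, ~ P i c) ->
  exists H, conic H /\ forall i c, P i c -> H (center c).
Proof.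
move=> nP; have [H [cH _]] := conic_through3 (0, 0) (0, 0) (0 : R, 0 : R).
by exists H; split=> // i c /nP.
Qed.

(** For every index there is at most one centre, and three points always lie
    on a conic. *)
Lemma three_circles_conic n (P : 'Z_n -> circle R -> Prop) : n = 3%N ->
  (forall i c c', P i c -> P i c' -> c = c') ->
  exists H, conic H /\ forall i c, P i c -> H (center c).
Proof.
move=> n3 uniq.
have /boolp.choice[z hz] i : exists z, forall c, P i c -> center c = z.
  case: (pselect (exists c, P i c)) => [[c Pc]|nc]; last first.
    by exists (0, 0) => c Pc; case: nc; exists c.
  by exists (center c) => c' Pc'; rewrite (uniq _ _ _ Pc Pc').
have [H [cH [H0 H1 H2]]] := conic_through3 (z 0) (z 1) (z (1 + 1)).
exists H; split=> // i c /hz ->; move: i; apply: Zn_ind => [//|i].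
have : [\/ i = 0, i = 1 | i = 1 + 1].
  move: i; apply: Zn_ind => [|i]; first by constructor 1.
  case=> ->; [by constructor 2; rewrite add0r|by constructor 3|].
  by constructor 1; subst n; apply/eqP.
case=> -> _; [by rewrite add0r|by []|].
by rewrite (_ : 1 + 1 + 1 = 0) //; subst n; apply/eqP.
Qed.

Lemma rotation_moves O a b S T n (C : 'Z_n -> plane R) j :
    ring_chain O S T C -> (forall i, C (i + j) = rotate O a b (C i)) ->
  j != 0 -> (a - 1) ^+ 2 + b ^+ 2 != 0.
Proof.
move=> [_ _ inj] hC j0; apply/eqP => ab0.
have e : C (0 + j) = C 0.
  by apply: sqdist_eq0; rewrite hC sqdistC sqdist_rotate ab0 mul0r.
by case/eqP: j0; move/inj: e; rewrite add0r.
Qed.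

(** The points of the first family are obtained from one another by a rotation
    about [O], so the chords from index [i] to index [i + j] have equal
    lengths. *)
Lemma mirror_chords_conic n w O nrm d a b S (p1 p2 : 'Z_n -> plane R) j :
    dot nrm nrm = 1 -> S != 0 -> (a - 1) ^+ 2 + b ^+ 2 != 0 ->
    (forall i, p1 i <> center w) -> (forall i, p2 i <> center w) ->
    (forall i, inversion w (p2 i) = refl nrm d (inversion w (p1 i))) ->
    (forall i, sqdist (inversion w (p1 i)) O = S) ->
    (forall i, inversion w (p1 (i + j)) = rotate O a b (inversion w (p1 i))) ->
  exists H, conic H /\ forall i c,
    the_circle_through c (p1 i) (p1 (i + j)) (p2 i) (p2 (i + j)) ->
    H (center c).
Proof.
move=> n1 S0 ab0 np1 np2 ep hS hrot.
have [H [cH hH]] := reflected_chord_conic w O d S n1 (mulf_neq0 ab0 S0).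
exists H; split=> // i c the_c; apply: (hH _ (p1 i) (p1 (i + j)) (p2 i) (p2 (i + j))).
- exact: symmetric_after_inversionI.
- exact: hS.
- exact: hS.
- by rewrite hrot sqdist_rotate hS.
Qed.

Lemma tangency_points_conic n w O1 O2 S T e1 e2
    (C1 C2 p1 p2 : 'Z_n -> plane R) j :
    (2 < n)%N -> ring_chain O1 S T C1 -> same_or_mirror O1 C1 O2 C2 ->
    e1 != 0 -> e1 ^+ 2 < 1 -> e2 ^+ 2 = e1 ^+ 2 ->
    (forall i, p1 i <> center w) -> (forall i, p2 i <> center w) ->
    (forall i, inversion w (p1 i) = along O1 (C1 i) (1 + e1)) ->
    (forall i, inversion w (p2 i) = along O2 (C2 i) (1 + e2)) ->
    (forall i i', i <> i' -> concyclic (p1 i) (p1 i') (p2 i) (p2 i')) ->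
    j != 0 ->
  exists H, conic H /\ forall i c,
    the_circle_through c (p1 i) (p1 (i + j)) (p2 i) (p2 (i + j)) ->
    H (center c).
Proof.
move=> n2 ch cases e10 e11 ee np1 np2 h1 h2 cyc j0.
have S0 := ring_chain_gt0 ch; have hS i : sqdist (C1 i) O1 = S by case: ch.
have t0 : 1 + e1 != 0.
  by apply/eqP => t0; move: e11; rewrite (_ : e1 = -1); [|lra];
    rewrite sqrrN expr1n ltxx.
have s0 : 1 - e1 != 0.
  by apply/eqP => s0; move: e11; rewrite (_ : e1 = 1); [|lra];
    rewrite expr1n ltxx.
have ts : 1 + e1 != 1 - e1.
  by apply/eqP => h; case/eqP: e10; lra.
have [a [b [_ hC1]]] := ring_chain_rotation n2 ch.
have [a' [b' hC]] := rotation_shift hC1 j.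
have ab0 := rotation_moves ch hC j0.
have rot t i : along O1 (C1 (i + j)) t = rotate O1 a' b' (along O1 (C1 i) t).
  by rewrite hC; apply: plane_eq; rewrite /along /rotate /=; ring.
have dist t i : sqdist (along O1 (C1 i) t) O1 = t ^+ 2 * S.
  by rewrite -(hS i) /along /sqdist /=; ring.
have /orP[] : (e2 == e1) || (e2 == - e1) by rewrite -eqf_sqr ee.
  move=> /eqP e12; rewrite {}e12 in h2.
  case: cases => [[eO eC]|[nrm [d [n1 _ eO eC]]]].
    apply: no_circle_conic => i c.
    have eq i' : p2 i' = p1 i'.
      by apply: (@inversion_inj _ w); rewrite h1 h2 eO eC.
    by rewrite !eq; apply: two_points_not_determined.
  apply: (@mirror_chords_conic _ w O1 nrm d a' b' ((1 + e1) ^+ 2 * S)) => //.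
  - by rewrite mulf_neq0 ?sqrf_eq0 // lt0r_neq0.
  - by move=> i; rewrite h1 h2 eO eC along_refl.
  - by move=> i; rewrite h1.
  - by move=> i; rewrite !h1.
move=> /eqP e12; rewrite {}e12 in h2.
case: cases => [[eO eC]|[nrm [d [n1 nd eO eC]]]].
  have ts0 : 1 + e1 + (1 - e1) != 0.
    by rewrite (_ : _ + _ = 2) ?pnatr_eq0 //; ring.
  have [H [cH hH]] := swapped_chord_conic w O1 S0
     (mulf_neq0 ab0 (lt0r_neq0 S0)) ts ts0.
  exists H; split=> // i c [thr _].
  apply: (hH _ (p1 i) (p1 (i + j)) (p2 i) (p2 (i + j)) (C1 i) (C1 (i + j))) => //.
  - by rewrite h2 -eO -eC.
  - by rewrite h2 -eO -eC.
  - by rewrite hC sqdist_rotate hS.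
have [n3|n3] := ltnP 3 n; last first.
  apply: three_circles_conic; first by apply/eqP; rewrite eqn_leq n3 n2.
  by move=> i c c' [_ uniq] [/uniq].
case: (swapped_reflection_absurd n3 ch n1 nd _ ts t0 s0); first by ring.
move=> i i' /cyc /(concyclic_inversion O1 (np1 _) (np1 _) (np2 _) (np2 _)).
by rewrite !h1 !h2 eO !eC !along_refl.
Qed.

Lemma midpoint_along O S T p q : sqdist p O = S -> sqdist q O = S ->
  sqdist p q = T -> sqdist (along p q 2^-1) O = S - T / 4.
Proof.
move=> hp hq hpq.
apply: (eq_comb (eqD (eqM 2^-1 (eqD hp hq)) (eqM (- 4^-1) hpq))).
by rewrite /along /sqdist /=; field.
Qed.

Lemma contact_points_conic n w O1 O2 S T e (C1 C2 p1 p2 : 'Z_n -> plane R) j :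
    (2 < n)%N -> ring_chain O1 S T C1 -> same_or_mirror O1 C1 O2 C2 ->
    e ^+ 2 < 1 -> 4 * (e ^+ 2 * S) = T ->
    (forall i, p1 i <> center w) -> (forall i, p2 i <> center w) ->
    (forall i, inversion w (p1 i) = along (C1 i) (C1 (i + 1)) 2^-1) ->
    (forall i, inversion w (p2 i) = along (C2 i) (C2 (i + 1)) 2^-1) ->
    j != 0 ->
  exists H, conic H /\ forall i c,
    the_circle_through c (p1 i) (p1 (i + j)) (p2 i) (p2 (i + j)) ->
    H (center c).
Proof.
move=> n2 ch cases e1 eS np1 np2 h1 h2 j0.
have S0 := ring_chain_gt0 ch; have [hS hT _] := ch.
case: cases => [[eO eC]|[nrm [d [n1 _ eO eC]]]].
  apply: no_circle_conic => i c.
  have eq i' : p2 i' = p1 i'.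
    by apply: (@inversion_inj _ w); rewrite h1 h2 !eC.
  by rewrite !eq; apply: two_points_not_determined.
have [a [b [_ hC1]]] := ring_chain_rotation n2 ch.
have [a' [b' hC]] := rotation_shift hC1 j.
apply: (@mirror_chords_conic _ w O1 nrm d a' b' (S - T / 4)) => //.
- rewrite -eS (_ : _ - _ = (1 - e ^+ 2) * S); last by field.
  by rewrite mulf_neq0 ?lt0r_neq0 // subr_gt0.
- exact: rotation_moves ch hC j0.
- by move=> i; rewrite h1 h2 !eC along_refl.
- by move=> i; rewrite h1; apply: midpoint_along.
- move=> i; rewrite !h1 addrAC !hC.
  by apply: plane_eq; rewrite /along /rotate /=; ring.
Qed.

(** Exchanging [p2] and [q2] changes the sign of [e2] but not the circle, so
    the signs may be taken to agree. *)
Lemma diameters_conic n w O1 O2 S T e1 e2 (C1 C2 : 'Z_n -> plane R)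
    (p1 q1 p2 q2 : 'Z_n -> plane R) :
    ring_chain O1 S T C1 -> same_or_mirror O1 C1 O2 C2 ->
    e1 != 0 -> e2 ^+ 2 = e1 ^+ 2 ->
    (forall i, p1 i <> center w) -> (forall i, q1 i <> center w) ->
    (forall i, p2 i <> center w) -> (forall i, q2 i <> center w) ->
    (forall i, inversion w (p1 i) = along O1 (C1 i) (1 + e1)) ->
    (forall i, inversion w (q1 i) = along O1 (C1 i) (1 - e1)) ->
    (forall i, inversion w (p2 i) = along O2 (C2 i) (1 + e2)) ->
    (forall i, inversion w (q2 i) = along O2 (C2 i) (1 - e2)) ->
  exists H, conic H /\ forall i c,
    the_circle_through c (p1 i) (q1 i) (p2 i) (q2 i) -> H (center c).
Proof.
move=> ch cases e10 ee np1 nq1 np2 nq2 hp1 hq1 hp2 hq2.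
wlog e12 : e2 p2 q2 ee np2 nq2 hp2 hq2 / e2 = e1.
  move=> wl; have /orP[/eqP|/eqP e12] : (e2 == e1) || (e2 == - e1).
  - by rewrite -eqf_sqr ee.
  - exact: wl.
  have [H [cH hH]] : exists H, conic H /\ forall i c,
      the_circle_through c (p1 i) (q1 i) (q2 i) (p2 i) -> H (center c).
    apply: (wl (- e2) q2 p2) => // [|i|]; first by rewrite sqrrN.
      by rewrite opprK.
    by rewrite e12 opprK.
  by exists H; split=> // i c /the_circle_throughC/hH.
subst e2; have hS i : sqdist (C1 i) O1 = S by case: ch.
case: cases => [[eO eC]|[nrm [d [n1 _ eO eC]]]].
  apply: no_circle_conic => i c.
  have -> : p2 i = p1 i by apply: (@inversion_inj _ w); rewrite hp1 hp2 eO eC.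
  have -> : q2 i = q1 i by apply: (@inversion_inj _ w); rewrite hq1 hq2 eO eC.
  exact: two_points_not_determined.
have ts : 1 + e1 != 1 - e1 by apply/eqP => h; case/eqP: e10; lra.
have [H [cH hH]] := reflected_ray_conic w O1 d S n1 ts.
exists H; split=> // i c the_c.
apply: (hH _ (p1 i) (q1 i) (p2 i) (q2 i) (C1 i)) => //.
apply: symmetric_after_inversionI => //.
- by rewrite hp1 hp2 eO eC along_refl.
- by rewrite hq1 hq2 eO eC along_refl.
Qed.

End Assembly.

(** * The theorem *)

Theorem theorem4p3 (R : realType) (n : nat) (hn : (3 <= n)%N)
    (l1 m1 l2 m2 : circle R) (k1 k2 : 'Z_n -> circle R)
    (chain1 : steiner_chain l1 m1 k1)
    (chain2 : steiner_chain l2 m2 k2)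
    (common : k1 1 = k2 1)
    (psi : exists w : circle R,
       sends_to_concentric w l1 m1 /\ sends_to_concentric w l2 m2)
    (L1 M1 N1 L2 M2 N2 : 'Z_n -> plane R)
    (hL1 : forall i, tangent_at (k1 i) l1 (L1 i))
    (hM1 : forall i, tangent_at (k1 i) m1 (M1 i))
    (hN1 : forall i, tangent_at (k1 i) (k1 (i + 1)) (N1 i))
    (hL2 : forall i, tangent_at (k2 i) l2 (L2 i))
    (hM2 : forall i, tangent_at (k2 i) m2 (M2 i))
    (hN2 : forall i, tangent_at (k2 i) (k2 (i + 1)) (N2 i))
    (concN : forall i j, i <> j -> concyclic (N1 i) (N1 j) (N2 i) (N2 j))
    (concL : forall i j, i <> j -> concyclic (L1 i) (L1 j) (L2 i) (L2 j))
    (concM : forall i j, i <> j -> concyclic (M1 i) (M1 j) (M2 i) (M2 j))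
    (concLM : forall i, concyclic (L1 i) (M1 i) (L2 i) (M2 i))
    (k : 'Z_n) (hk : k <> 1) :
  [/\ exists H : set (plane R), conic H /\
        forall (i : 'Z_n) (c : circle R),
          the_circle_through c (N1 i) (N1 (i + k - 1)) (N2 i) (N2 (i + k - 1)) ->
          H (center c),
      exists H : set (plane R), conic H /\
        forall (i : 'Z_n) (c : circle R),
          the_circle_through c (L1 i) (L1 (i + k - 1)) (L2 i) (L2 (i + k - 1)) ->
          H (center c),
      exists H : set (plane R), conic H /\
        forall (i : 'Z_n) (c : circle R),
          the_circle_through c (M1 i) (M1 (i + k - 1)) (M2 i) (M2 (i + k - 1)) ->
          H (center c) &
      exists H : set (plane R), conic H /\
        forall (i : 'Z_n) (c : circle R),
          the_circle_through c (L1 i) (M1 i) (L2 i) (M2 i) ->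
          H (center c)].
Proof.
have [w [sc1 sc2]] := psi.
have [k1' [O1 [S1 [T1 [e1 [inv1 ch1 [e10 e11 eS1] rad1 pts1]]]]]] :=
  inverted_steiner_chain sc1 chain1.
have [k2' [O2 [S2 [T2 [e2 [inv2 ch2 [e20 e21 eS2] rad2 pts2]]]]]] :=
  inverted_steiner_chain sc2 chain2.
have k'1 : k1' 1 = k2' 1.
  by apply: inverts_fun (inv1 1) _; rewrite common; apply: inv2.
have eT : T2 = T1 by rewrite -(rad1 1) k'1 rad2.
rewrite {}eT in ch2 eS2 rad2.
have hL i : [/\ L1 i <> center w, L2 i <> center w,
    inversion w (L1 i) = along O1 (center (k1' i)) (1 + e1) &
    inversion w (L2 i) = along O2 (center (k2' i)) (1 + e2)].
  have [/(_ (hL1 i))[? ?] _ _] := pts1 i (L1 i).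
  by have [/(_ (hL2 i))[? ?] _ _] := pts2 i (L2 i).
have hM i : [/\ M1 i <> center w, M2 i <> center w,
    inversion w (M1 i) = along O1 (center (k1' i)) (1 - e1) &
    inversion w (M2 i) = along O2 (center (k2' i)) (1 - e2)].
  have [_ /(_ (hM1 i))[? ?] _] := pts1 i (M1 i).
  by have [_ /(_ (hM2 i))[? ?] _] := pts2 i (M2 i).
have hN i : [/\ N1 i <> center w, N2 i <> center w,
    inversion w (N1 i) = along (center (k1' i)) (center (k1' (i + 1))) 2^-1 &
    inversion w (N2 i) = along (center (k2' i)) (center (k2' (i + 1))) 2^-1].
  have [_ _ /(_ (hN1 i))[? ?]] := pts1 i (N1 i).
  by have [_ _ /(_ (hN2 i))[? ?]] := pts2 i (N2 i).
have cases : same_or_mirror O1 (fun i => center (k1' i))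
                            O2 (fun i => center (k2' i)).
  apply: (same_or_reflected hn ch1 ch2 _ e10 eS1 e20 eS2) => [|i].
    by rewrite k'1.
  have [nL1 nL2 eL1 eL2] := hL i; have [nM1 nM2 eM1 eM2] := hM i.
  rewrite -eL1 -eL2 -eM1 -eM2.
  exact: (concyclic_inversion _ nL1 nM1 nL2 nM2 (concLM i)).
have eS : S2 = S1.
  have [hS1 _ _] := ch1; have [hS2 _ _] := ch2.
  rewrite -(hS1 1) -(hS2 1); case: cases => [[-> ->] //|].
  by move=> [nrm [d [n1 _ -> ->]]]; rewrite sqdist_refl.
have ee : e2 ^+ 2 = e1 ^+ 2.
  apply: (mulIf (lt0r_neq0 (ring_chain_gt0 ch1))).
  by apply: (mulfI (x := 4)); rewrite ?pnatr_eq0 // eS1 -{1}eS eS2.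
have k0 : k - 1 != 0 by rewrite subr_eq0; apply/eqP.
split.
- have [H [cH hH]] := contact_points_conic hn ch1 cases e11 eS1
    (fun i => let: And4 h _ _ _ := hN i in h)
    (fun i => let: And4 _ h _ _ := hN i in h)
    (fun i => let: And4 _ _ h _ := hN i in h)
    (fun i => let: And4 _ _ _ h := hN i in h) k0.
  by exists H; split=> // i c; rewrite -addrA; apply: hH.
- have [H [cH hH]] := tangency_points_conic hn ch1 cases e10 e11 ee
    (fun i => let: And4 h _ _ _ := hL i in h)
    (fun i => let: And4 _ h _ _ := hL i in h)
    (fun i => let: And4 _ _ h _ := hL i in h)
    (fun i => let: And4 _ _ _ h := hL i in h) concL k0.
  by exists H; split=> // i c; rewrite -addrA; apply: hH.
- have [|||H [cH hH]] := @tangency_points_conic _ _ w _ _ _ _ (- e1) (- e2)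
    _ _ M1 M2 (k - 1) hn ch1 cases _ _ _
    (fun i => let: And4 h _ _ _ := hM i in h)
    (fun i => let: And4 _ h _ _ := hM i in h)
    (fun i => let: And4 _ _ h _ := hM i in h)
    (fun i => let: And4 _ _ _ h := hM i in h) concM k0.
  + by rewrite oppr_eq0.
  + by rewrite sqrrN.
  + by rewrite !sqrrN.
  by exists H; split=> // i c; rewrite -addrA; apply: hH.
- exact: (diameters_conic ch1 cases e10 ee
    (fun i => let: And4 h _ _ _ := hL i in h)
    (fun i => let: And4 h _ _ _ := hM i in h)
    (fun i => let: And4 _ h _ _ := hL i in h)
    (fun i => let: And4 _ h _ _ := hM i in h)
    (fun i => let: And4 _ _ h _ := hL i in h)
    (fun i => let: And4 _ _ h _ := hM i in h)
    (fun i => let: And4 _ _ _ h := hL i in h)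
    (fun i => let: And4 _ _ _ h := hM i in h)).
Qed.
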